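(* Let $m\ge1$ and let $\phi_m:\mathcal{L}^{(0,m)}+\sum_{i=1}^3\mathbb{C}z_i\to\mathbb{C}$ be a Lie algebra homomorphism with $\phi_m(z_3)=0$. Then the universal Whittaker module $\widetilde W_{\phi_m}$ is simple if and only if $\phi_m(I_m)\ne0$.
   Context: $\mathcal{L}$ has basis $\{d_n,I_n,z_1,z_2,z_3\mid n\in\mathbb{Z}\}$ with brackets $[d_n,d_m]=(m-n)d_{m+n}+\delta_{n,-m}\frac{n^3-n}{12}z_1$, $[d_n,I_m]=mI_{m+n}+\delta_{n,-m}(n^2+n)z_2$, $[I_n,I_m]=n\delta_{n,-m}z_3$, $z_i$ central. $\mathcal{L}^{(0,m)}=\mathrm{span}\{I_i,d_{m+i}\mid i\ge0\}$. $\mathbb{C}w_{\phi_m}$ is the one-dimensional $\mathcal{L}^{(0,m)}+\sum_i\mathbb{C}z_i$-module with $xw_{\phi_m}=\phi_m(x)w_{\phi_m}$, and $\widetilde W_{\phi_m}=\mathrm{Ind}_{\mathcal{L}^{(0,m)}+\sum_i\mathbb{C}z_i}^{\mathcal L}\mathbb{C}w_{\phi_m}$. *)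

(* Defs.v *)
From HB Require Import structures.
From mathcomp Require Import all_boot all_order all_algebra.
From mathcomp Require Import complex.
From mathcomp Require Import Rstruct.
Set Implicit Arguments. Unset Strict Implicit. Unset Printing Implicit Defensive.
Import Order.TTheory GRing.Theory Num.Theory.
Local Open Scope ring_scope.

Definition CC : fieldType := (Rdefinitions.R)[i].

(* A representation (module) of the Lie algebra L with basis
   {d_n, I_n, z_1, z_2, z_3 | n in Z} on a C-vector space V: linear maps
   rd n = rho(d_n), rI n = rho(I_n), rz1/rz2/rz3 = rho(z_i) such that the
   commutators satisfy the defining brackets of L (z_i central). *)
Record Lrep (V : lmodType CC) := {
  rd : int -> V -> V;
  rI : int -> V -> V;
  rz1 : V -> V;
  rz2 : V -> V;
  rz3 : V -> V;
  rd_lin : forall n, linear (rd n);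
  rI_lin : forall n, linear (rI n);
  rz1_lin : linear rz1;
  rz2_lin : linear rz2;
  rz3_lin : linear rz3;
  br_dd : forall n k v, rd n (rd k v) - rd k (rd n v) =
     (k - n)%:~R *: rd (k + n) v
     + (if n == - k then ((n ^+ 3 - n)%:~R / 12%:R) *: rz1 v else 0);
  br_dI : forall n k v, rd n (rI k v) - rI k (rd n v) =
     k%:~R *: rI (k + n) v
     + (if n == - k then (n ^+ 2 + n)%:~R *: rz2 v else 0);
  br_II : forall n k v, rI n (rI k v) - rI k (rI n v) =
     (if n == - k then n%:~R *: rz3 v else 0);
  z1_d : forall n v, rz1 (rd n v) = rd n (rz1 v);
  z2_d : forall n v, rz2 (rd n v) = rd n (rz2 v);
  z3_d : forall n v, rz3 (rd n v) = rd n (rz3 v);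
  z1_I : forall n v, rz1 (rI n v) = rI n (rz1 v);
  z2_I : forall n v, rz2 (rI n v) = rI n (rz2 v);
  z3_I : forall n v, rz3 (rI n v) = rI n (rz3 v);
  z12 : forall v, rz1 (rz2 v) = rz2 (rz1 v);
  z13 : forall v, rz1 (rz3 v) = rz3 (rz1 v);
  z23 : forall v, rz2 (rz3 v) = rz3 (rz2 v)
}.

(* A linear functional phi on L^{(0,m)} + sum_i C z_i, given on the basis:
   phD n = phi(d_n) (used for n >= m), phI n = phi(I_n) (used for n >= 0),
   p1 p2 p3 = phi(z_1), phi(z_2), phi(z_3).
   It is a Lie algebra homomorphism to C (abelian) iff it kills all brackets
   of basis elements of the subalgebra (brackets with z_i are 0). *)
Definition is_Lie_hom (m : nat) (phD phI : int -> CC) (p1 p2 p3 : CC) : Prop :=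
  (forall a b : int, (m%:Z <= a)%R -> (m%:Z <= b)%R ->
     (b - a)%:~R * phD (b + a)
     + (if a == - b then ((a ^+ 3 - a)%:~R / 12%:R) * p1 else 0) = 0)
  /\ (forall a b : int, (m%:Z <= a)%R -> (0 <= b)%R ->
     b%:~R * phI (b + a)
     + (if a == - b then (a ^+ 2 + a)%:~R * p2 else 0) = 0)
  /\ (forall a b : int, (0 <= a)%R -> (0 <= b)%R ->
     (if a == - b then a%:~R * p3 else 0) = 0).

(* w is a Whittaker vector of type phi: x w = phi(x) w for all x in
   L^{(0,m)} + sum_i C z_i (enough on the basis {I_i, d_{m+i} | i >= 0}, z_i). *)
Definition whittaker_vec (m : nat) (phD phI : int -> CC) (p1 p2 p3 : CC)
    (V : lmodType CC) (rho : Lrep V) (w : V) : Prop :=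
  (forall i : int, (0 <= i)%R -> rI rho i w = phI i *: w)
  /\ (forall i : int, (0 <= i)%R -> rd rho (m%:Z + i) w = phD (m%:Z + i) *: w)
  /\ rz1 rho w = p1 *: w /\ rz2 rho w = p2 *: w /\ rz3 rho w = p3 *: w.

Definition Lhom (V V' : lmodType CC) (rho : Lrep V) (rho' : Lrep V')
    (f : V -> V') : Prop :=
  linear f
  /\ (forall n v, f (rd rho n v) = rd rho' n (f v))
  /\ (forall n v, f (rI rho n v) = rI rho' n (f v))
  /\ (forall v, f (rz1 rho v) = rz1 rho' (f v))
  /\ (forall v, f (rz2 rho v) = rz2 rho' (f v))
  /\ (forall v, f (rz3 rho v) = rz3 rho' (f v)).

(* (V, rho, w) is the universal Whittaker module
   Ind_{L^{(0,m)} + sum C z_i}^{L} C w_phi, characterised by the universal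
   property of induction: w is a Whittaker vector of type phi, and for every
   L-module V' with a Whittaker vector w' of type phi there is a unique
   L-module homomorphism V -> V' sending w to w'. *)
Definition universal_whittaker (m : nat) (phD phI : int -> CC) (p1 p2 p3 : CC)
    (V : lmodType CC) (rho : Lrep V) (w : V) : Prop :=
  whittaker_vec m phD phI p1 p2 p3 rho w
  /\ forall (V' : lmodType CC) (rho' : Lrep V') (w' : V'),
       whittaker_vec m phD phI p1 p2 p3 rho' w' ->
       exists f : V -> V', (Lhom rho rho' f /\ f w = w')
         /\ forall g : V -> V', Lhom rho rho' g -> g w = w' -> forall v, g v = f v.

Definition submodule (V : lmodType CC) (rho : Lrep V) (S : V -> Prop) : Prop :=
  S 0
  /\ (forall u v, S u -> S v -> S (u + v))
  /\ (forall (a : CC) v, S v -> S (a *: v))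
  /\ (forall n v, S v -> S (rd rho n v))
  /\ (forall n v, S v -> S (rI rho n v))
  /\ (forall v, S v -> S (rz1 rho v))
  /\ (forall v, S v -> S (rz2 rho v))
  /\ (forall v, S v -> S (rz3 rho v)).

Definition simple_module (V : lmodType CC) (rho : Lrep V) : Prop :=
  (exists v : V, v != 0)
  /\ forall S : V -> Prop, submodule rho S ->
       (forall v, S v -> v = 0) \/ (forall v, S v).

(* Main.v *)
(** The induced module is realised by a Poincare-Birkhoff-Witt construction on the
    free vector space over commutative monomials in the letters [d_n] ([n < m])
    and [I_n] ([n < 0]); the letters [d_n] ([n >= m]), [I_n] ([n >= 0]) span the
    subalgebra and act on the unit monomial through [phi].

    If [phi I_m <> 0], then [I_K - phi I_K] and [d_(m+J) - phi d_(m+J)] act on the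
    monomials, up to terms of lower weight, as nonzero multiples of the partial
    derivatives in [d_(m-K)] and [I_(-J)], because [[d_(m-K), I_K] = K I_m] and
    [[d_(m+J), I_(-J)] = - J I_m]. Hence every nonzero vector can be lowered to
    the unit monomial and the module is simple.

    If [phi I_m = 0], there is a second Whittaker vector, not proportional to the
    generator [w]: either [d_(m-1) w] or a polynomial in the [I_(-j)] applied to
    [w], with correction terms. The endomorphism sending [w] to it strictly raises
    weights, so its image is a proper nonzero submodule. *)

Require Import Defs.
From Stdlib Require Import Classical.
From HB Require Import structures.
From mathcomp Require Import all_boot all_order all_algebra.
From mathcomp Require Import complex.
From mathcomp Require Import Rstruct.
From mathcomp Require Import finmap monalg.
From mathcomp Require Import zify ring.
Set Implicit Arguments. Unset Strict Implicit. Unset Printing Implicit Defensive.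
Import Order.TTheory GRing.Theory Num.Theory.
Local Open Scope ring_scope.

(** A character kills brackets, so [phi (I_n)] vanishes for [n > m] and [phi (d_n)] for [n > 2m]. As
    [z_3] acts by zero, the [I_n] commute: products of [I_(-j)] applied to [w] meet the Whittaker
    conditions for all [I_k], and only those for the [d_n] remain. If [phi I_m = 0], the vector
    [d_(m-1) w] also meets the conditions for the [I_k], and it can fail only those for [d_m] and
    [d_(m+1)]. Two correcting vectors are therefore enough, and their shape depends on the last [r]
    with [phi I_r <> 0], if there is a positive one.

    In the simple case the obstacle is that a subalgebra element does not merely remove letters:
    bracketed with a letter far down it creates another letter, as [I_K] turns [d_(m-k)] into
    [I_(m-k+K)] when [k > K + m]. Such a term has the same length as the original word, so length
    cannot show that it is negligible. The weight grows with the depth of a letter, and every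
    unwanted term must lose more weight than the removal of the target letter does. *)

(** * Free vector spaces and supports *)

Record free_module (K : fieldType) (T : choiceType) := FreeModule {
  fm_sort :> lmodType K;
  gen : T -> fm_sort;
  coef : T -> fm_sort -> K;
  linext : forall M : lmodType K, (T -> M) -> fm_sort -> M;
  coef_linear : forall k, scalar (coef k);
  coef_gen : forall k l, coef l (gen k) = (k == l)%:R;
  linext_linear : forall M f, linear (@linext M f);
  linext_gen : forall M f k, @linext M f (gen k) = f k;
  finite_support : forall v, exists r : seq T, forall k, coef k v != 0 -> k \in r;
  support_ind : forall (P : fm_sort -> Prop) v, P 0 ->
    (forall a u w, P u -> P w -> P (a *: u + w)) ->
    (forall k, coef k v != 0 -> P (gen k)) -> P v
}.

(* Opaque: unification must never unfold the module operations. *)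
Lemma free_module_on (K : fieldType) (T : choiceType) : free_module K T.
Proof.
pose ext (M : lmodType K) (f : T -> M) (v : {malg K[T]}) : M :=
  \sum_(k <- msupp v) v@_k *: f k.
have extEw M f v (d : {fset T}) :
    (msupp v `<=` d)%fset -> @ext M f v = \sum_(k <- d) v@_k *: f k.
  move=> vd; rewrite /ext (big_fset_incl _ vd) // => k _ kv.
  by rewrite mcoeff_outdom // scale0r.
have scaleU (a : K) (k : T) : << a *g k >> = a *: << k >>.
  by apply/malgP => k'; rewrite mcoeffZ !mcoeffU mulrnAr mulr1.
exists {malg K[T]} (fun k => << k >>) (fun k v => v@_k) ext.
- by move=> k a u v; rewrite mcoeffD mcoeffZ.
- by move=> k l; rewrite mcoeffU.
- move=> M f a u v; pose d := (msupp u `|` msupp v)%fset.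
  have ud : (msupp u `<=` d)%fset by rewrite fsubsetUl.
  have vd : (msupp v `<=` d)%fset by rewrite fsubsetUr.
  have ad : (msupp (a *: u + v) `<=` d)%fset.
    apply: fsubset_trans (msuppD_le _ _) _; rewrite fsetSU //; exact: msuppZ_le.
  rewrite (extEw _ _ _ _ ud) (extEw _ _ _ _ vd) (extEw _ _ _ _ ad).
  rewrite scaler_sumr -big_split /=.
  by apply: eq_bigr => k _; rewrite mcoeffD mcoeffZ scalerDl scalerA.
- by move=> M f k; rewrite /ext msuppU oner_eq0 big_seq_fset1 mcoeffUU scale1r.
- by move=> v; exists (msupp v) => k; rewrite mcoeff_neq0.
- move=> P v P0 PD PU; rewrite [v]monalgE big_seq.
  elim/big_ind: _ => // [x y Px Py|k].
    by rewrite -[x]scale1r; apply: PD.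
  rewrite -mcoeff_neq0 scaleU => /PU Pk; rewrite -[_ *: _]addr0; exact: PD.
Qed.

Section FreeModule.
Variables (K : fieldType) (T : choiceType) (F : free_module K T).
Implicit Types (u v : F) (p q : pred T).

HB.instance Definition _ (M : lmodType K) (f : T -> M) :=
  GRing.isLinear.Build K F M *:%R (@linext K T F M f) (@linext_linear K T F M f).
HB.instance Definition _ k :=
  GRing.isLinear.Build K F K *%R (@coef K T F k) (@coef_linear K T F k).

(** Both filtrations, by length and by weight, are written with a bound on words as [p]; linear
    statements about them are then checked on generators only. *)
Definition supported p v := forall k, coef k v != 0 -> p k.

Lemma supported0 p : supported p 0.
Proof. by move=> k; rewrite linear0 eqxx. Qed.

Lemma supportedD p u v : supported p u -> supported p v -> supported p (u + v).
Proof.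
move=> pu pv k; rewrite linearD /=; case: (eqVneq (coef k u) 0) => [->|/pu//].
by rewrite add0r; apply: pv.
Qed.

Lemma supportedZ p a v : supported p v -> supported p (a *: v).
Proof. by move=> pv k; rewrite linearZ /= mulf_eq0 negb_or => /andP[_ /pv]. Qed.

Lemma supported_gen p k : p k -> supported p (gen F k).
Proof. by move=> pk l; rewrite coef_gen; case: (eqVneq k) => [<-|_]; rewrite ?eqxx. Qed.

Lemma supportedW p q v : (forall k, p k -> q k) -> supported p v -> supported q v.
Proof. by move=> pq pv k /pv/pq. Qed.

Lemma supported_ind p (P : F -> Prop) v :
  P 0 -> (forall a u w, P u -> P w -> P (a *: u + w)) ->
  (forall k, p k -> P (gen F k)) -> supported p v -> P v.
Proof. by move=> P0 PD PU pv; apply: support_ind => // k /pv/PU. Qed.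

Lemma free_ind (P : F -> Prop) :
  P 0 -> (forall a u w, P u -> P w -> P (a *: u + w)) ->
  (forall k, P (gen F k)) -> forall v, P v.
Proof. by move=> P0 PD PU v; apply: support_ind. Qed.

Lemma coef_eq0 v : (forall k, coef k v = 0) -> v = 0.
Proof.
move=> v0; apply: (@support_ind _ _ F (fun v => v = 0)) => // [a u w -> ->|k].
  by rewrite scaler0 addr0.
by rewrite v0 eqxx.
Qed.

Lemma fm_coefD k u v : coef k (u + v) = coef k u + coef k v.
Proof. exact: linearD. Qed.

Lemma fm_coefZ k a v : coef k (a *: v) = a * coef k v.
Proof. exact: linearZ. Qed.

Lemma fm_coefN k v : coef k (- v) = - coef k v.
Proof. exact: linearN. Qed.

Lemma fm_coef0 k : coef k (0 : F) = 0.
Proof. exact: linear0. Qed.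

Definition coef_linE := (fm_coefD, fm_coefZ, fm_coefN, fm_coef0).

Lemma coefP u v : (forall k, coef k u = coef k v) -> u = v.
Proof.
move=> uv; apply/eqP; rewrite -subr_eq0; apply/eqP/coef_eq0 => k.
by rewrite linearB /= uv subrr.
Qed.

Lemma linear_eq_supported p (M : lmodType K) (f g : {linear F -> M}) v :
  (forall k, p k -> f (gen F k) = g (gen F k)) -> supported p v -> f v = g v.
Proof.
move=> fg; apply: (@supported_ind p (fun v => f v = g v)) => [|a u w fu fw|//].
  by rewrite !linear0.
by rewrite !linearP fu fw.
Qed.

Lemma supported_linear p q (f : {linear F -> F}) v :
  (forall k, p k -> supported q (f (gen F k))) -> supported p v -> supported q (f v).
Proof.
move=> fq; apply: (@supported_ind p (fun v => supported q (f v))) => //.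
  by rewrite linear0; apply: supported0.
move=> a u w qu qw; rewrite linearP.
by apply: supportedD => //; apply: supportedZ.
Qed.

End FreeModule.

(** * Commutative monomials as sorted words *)

Section Words.
Variables (K : fieldType) (X : countType).
Implicit Types (i j : X) (s t : seq X).

(* Any decidable total order on the letters will do; monomials are encoded as
   sorted sequences. *)
Definition pleq i j := (choice.pickle i <= choice.pickle j)%N.

Lemma pleq_total : total pleq.
Proof. by move=> i j; apply: leq_total. Qed.

Lemma pleq_trans : transitive pleq.
Proof. by move=> i j k; apply: leq_trans. Qed.

Lemma pleq_anti : antisymmetric pleq.
Proof. by move=> i j; rewrite /pleq -eqn_leq => /eqP/(pcan_inj choice.pickleK). Qed.

Definition word := {s : seq X | sorted pleq s}.

Definition spell (w : word) : seq X := sval w.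

Lemma spellP w : sorted pleq (spell w).
Proof. exact: svalP w. Qed.

Lemma spell_inj : injective spell.
Proof. exact: val_inj. Qed.

Definition to_word s : word := exist _ (sort pleq s) (sort_sorted pleq_total s).

Lemma to_wordP s t : reflect (to_word s = to_word t) (perm_eq s t).
Proof.
apply: (iffP (perm_sortP pleq_total pleq_trans pleq_anti _ _)).
  by move=> st; apply: spell_inj.
by move=> /(congr1 spell).
Qed.

Lemma spell_to_word s : sorted pleq s -> spell (to_word s) = s.
Proof. exact: sorted_sort pleq_trans _. Qed.

Lemma perm_spell_to_word s : perm_eq (spell (to_word s)) s.
Proof. by rewrite perm_sort. Qed.

Lemma to_word_spell (w : word) : to_word (spell w) = w.
Proof. by apply: spell_inj; rewrite spell_to_word // (spellP w). Qed.

Definition mon s : free_module_on K word := gen _ (to_word s).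

Lemma mon_spell (w : word) : gen (free_module_on K word) w = mon (spell w).
Proof. by rewrite /mon to_word_spell. Qed.

Lemma mon_perm s t : perm_eq s t -> mon s = mon t.
Proof. by move=> /to_wordP; rewrite /mon => ->. Qed.

Lemma coef_mon s (w : word) : coef w (mon s) = (perm_eq s (spell w))%:R.
Proof.
rewrite /mon coef_gen -{1}[w]to_word_spell.
have -> // : (to_word s == to_word (spell w)) = perm_eq s (spell w).
by apply/eqP/idP => /to_wordP.
Qed.

Lemma mon_supported (p : pred word) s : p (to_word s) -> supported p (mon s).
Proof. exact: supported_gen. Qed.

Lemma sorted_cons_all i s : sorted pleq (i :: s) = all (pleq i) s && sorted pleq s.
Proof. by rewrite /= path_sortedE //; apply: pleq_trans. Qed.
End Words.
Arguments pleq {X}.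
Arguments spell : simpl never.

(** * Construction of the induced action *)

(* A Lie algebra with basis [G] in which [[x, y] = c x y * br x y + om x y], the
   central part being already evaluated to a scalar. A basis element [x] with
   [index x = None] belongs to the subalgebra on which [phi] is a character; the
   others are the letters [letter i], which form a basis of a complement. *)
Section InducedModule.
Variables (K : fieldType) (X : countType) (G : Type).
Variables (letter : X -> G) (index : G -> option X).
Variables (c om : G -> G -> K) (br : G -> G -> G) (phi : G -> K).

Hypothesis letterK : forall i, index (letter i) = Some i.
Hypothesis indexK : forall x i, index x = Some i -> letter i = x.

Local Notation S := (free_module_on K (word X)).
Local Notation mon := (@mon K X).
Implicit Types (x y z : G) (i j k : X) (s t : seq X) (w : word X) (u v : S).

(** The symbol of [x] on the associated graded module: multiplication by a letter, zero on the
    subalgebra. *)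
Definition ins x s : S := if index x is Some i then mon (i :: s) else 0.

(** In this case prepending the letter keeps a sorted word sorted, so that no correction arises. *)
Definition small x s := if index x is Some i then all (pleq i) s else false.

(* [x (mon s) = ins x s + low n x s] for any [n >= size s]: the recursion is forced
   by [x y t = y x t + [x, y] t], and [low] does not increase lengths, so that the
   fuel [n] suffices. *)
Fixpoint low n x s : S :=
  match n, s with
  | _, [::] => if index x is Some _ then 0 else phi x *: mon [::]
  | 0, _ => 0
  | n'.+1, i :: t =>
    if small x s then 0 else
    let y := letter i in
    linext (fun w : word X => ins y (spell w) + low n' y (spell w)) (low n' x t)
    + c x y *: (ins (br x y) t + low n' (br x y) t) + om x y *: mon t
  end.

Lemma low_nil n x : low n x [::] = if index x is Some _ then 0 else phi x *: mon [::].
Proof. by case: n => [|n]; rewrite /low. Qed.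

Lemma low_cons n x i t : low n.+1 x (i :: t) =
  if small x (i :: t) then 0 else
  linext (fun w : word X => ins (letter i) (spell w) + low n (letter i) (spell w)) (low n x t)
  + c x (letter i) *: (ins (br x (letter i)) t + low n (br x (letter i)) t)
  + om x (letter i) *: mon t.
Proof. by rewrite {1}/low -/low. Qed.

Arguments low : simpl never.

Definition act x v : S :=
  linext (fun w : word X => ins x (spell w) + low (size (spell w)) x (spell w)) v.

Fact act_is_linear x : linear (act x).
Proof. exact: linext_linear. Qed.
HB.instance Definition _ x :=
  GRing.isLinear.Build K S S *:%R (act x) (act_is_linear x).

Lemma actZ x a v : act x (a *: v) = a *: act x v.
Proof. exact: linearZ. Qed.

Definition len_le n : pred (word X) := fun w => (size (spell w) <= n)%N.

Lemma mon_len n s : (size s <= n)%N -> supported (len_le n) (mon s).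
Proof. by move=> sn; apply: mon_supported; rewrite /len_le (perm_size (perm_spell_to_word s)). Qed.

Lemma ins_len n x s : (size s < n)%N -> supported (len_le n) (ins x s).
Proof.
rewrite /ins; case: (index x) => [i|] sn; last exact: supported0.
exact: mon_len.
Qed.

Lemma low_len n x s : (size s <= n)%N -> supported (len_le (size s)) (low n x s).
Proof.
elim: n x s => [|n IHn] x [|i t] //; rewrite ?low_nil ?low_cons;
  try by case: (index x) => [j|] _; [exact: supported0|apply: supportedZ; apply: mon_len].
rewrite [size _]/= ltnS => tn; case: ifP => _; first exact: supported0.
apply: supportedD; last by apply: supportedZ; apply: mon_len.
apply: supportedD.
  apply: (@supported_linear _ _ _ (len_le (size t))); last exact: IHn.
  move=> w; rewrite /len_le => wt; rewrite /= linext_gen.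
  apply: supportedD; first by apply: ins_len; rewrite ltnS.
  apply: supportedW (IHn _ _ _); last exact: leq_trans tn.
  by move=> k; rewrite /len_le => /leq_trans; apply; apply: leqW.
apply: supportedZ; apply: supportedD; first exact: ins_len.
apply: supportedW (IHn _ _ _) => // k; rewrite /len_le => /leq_trans; apply.
exact: leqW.
Qed.

Lemma low_fuel n n' x s : (size s <= n)%N -> (size s <= n')%N ->
  low n x s = low n' x s.
Proof.
elim: n n' x s => [|n IHn] n' x [|i t]; rewrite ?low_nil; try reflexivity.
  by [].
case: n' => [|n']; first by [].
rewrite [size _]/= !ltnS => tn tn'; rewrite !low_cons.
case: (small _ _) => //.
rewrite (IHn n' x t tn tn') (IHn n' (br x (letter i)) t tn tn').
apply: (congr2 +%R) => //; apply: (congr2 +%R) => //.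
apply: (@linear_eq_supported _ _ _ (len_le (size t))); last exact: low_len.
move=> w wt; rewrite /= !linext_gen; apply: (congr2 +%R) => //.
by apply: IHn; apply: leq_trans wt _.
Qed.

Lemma ins_perm x s t : perm_eq s t -> ins x s = ins x t.
Proof.
by rewrite /ins; case: (index x) => // i st; apply: mon_perm; rewrite perm_cons.
Qed.

Lemma act_mon x s : sorted pleq s -> act x (mon s) = ins x s + low (size s) x s.
Proof. by move=> ss; rewrite /act /mon linext_gen spell_to_word. Qed.

Lemma act_low x s : sorted pleq s ->
  supported (len_le (size s)) (act x (mon s) - ins x s).
Proof. by move=> ss; rewrite act_mon // addrC addKr; apply: low_len. Qed.

Lemma act_small x i s : index x = Some i -> all (pleq i) s ->
  act x (mon s) = mon (i :: s).
Proof.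
move=> xi; rewrite -(perm_all _ (introT permPl (perm_sort pleq s))) => si.
have -> : mon s = mon (sort pleq s) by apply: mon_perm; rewrite perm_sym perm_sort.
rewrite act_mon ?sort_sorted //; last exact: pleq_total.
rewrite (ins_perm _ (introT permPl (perm_sort pleq s))) {1}/ins xi.
case: (sort pleq s) si => [|j t] si; first by rewrite low_nil xi addr0.
by rewrite low_cons /small xi si addr0.
Qed.

Lemma act_letter i s : sorted pleq (i :: s) -> act (letter i) (mon s) = mon (i :: s).
Proof. by rewrite sorted_cons_all => /andP[ai _]; apply: act_small. Qed.

Lemma act_base x : index x = None -> act x (mon [::]) = phi x *: mon [::].
Proof. by move=> xN; rewrite act_mon // /ins low_nil xN add0r. Qed.

(** If [x] is a letter, failing to be small places it after [i]; thus [i] is least in the whole word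
    and inserting it costs nothing. *)
Lemma small_ins x i s : sorted pleq (i :: s) -> ~~ small x (i :: s) ->
  act (letter i) (ins x s) = ins x (i :: s).
Proof.
rewrite sorted_cons_all /small /ins => /andP[ia ss].
case xj : (index x) => [j|]; last by rewrite linear0.
move=> /= nji; rewrite (@act_small _ i) //=.
  by apply: mon_perm; apply/permP => p /=; rewrite addnCA.
rewrite ia andbT; case/orP: (pleq_total i j) => // ji; case/negP: nji.
by rewrite ji; apply: sub_all ia => k; apply: pleq_trans.
Qed.

Lemma act_big x i s : sorted pleq (i :: s) -> ~~ small x (i :: s) ->
  act x (mon (i :: s)) = act (letter i) (act x (mon s))
    + c x (letter i) *: act (br x (letter i)) (mon s) + om x (letter i) *: mon s.
Proof.
move=> si xs; have /andP[_ ss] : all (pleq i) s && sorted pleq s.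
  by rewrite -sorted_cons_all.
rewrite act_mon // low_cons (negbTE xs) -act_mon //.
rewrite (act_mon x ss) linearD /= small_ins // !addrA.
do 3 apply: (congr2 +%R) => //.
apply: (@linear_eq_supported _ _ _ (len_le (size s))); last exact: low_len.
move=> w ws; rewrite /= linext_gen mon_spell act_mon ?(spellP w) //; apply: (congr2 +%R) => //.
exact: low_fuel.
Qed.

(** * The bracket relations on the induced module *)

Hypothesis cN : forall x y, c y x = - c x y.
Hypothesis omN : forall x y, om y x = - om x y.
Hypothesis c_diag : forall x, c x x = 0.
Hypothesis om_diag : forall x, om x x = 0.
Hypothesis brC : forall x y, br x y = br y x.
Hypothesis brA : forall x y z, br x (br y z) = br (br x y) z.
(** By commutativity and associativity of [br], all iterated brackets of [x], [y], [z] are multiples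
    of one basis element, so the Jacobi identity reduces to one scalar identity here and one for the
    central part. *)
Hypothesis c_jacobi : forall x y z,
  c x z * c (br x z) y + c y z * c x (br y z) = c x y * c (br x y) z.
Hypothesis om_jacobi : forall x y z,
  c x z * om (br x z) y + c y z * om x (br y z) = c x y * om (br x y) z.
Hypothesis sub_br : forall x y,
  index x = None -> index y = None -> index (br x y) = None.
Hypothesis phi_hom : forall x y, index x = None -> index y = None ->
  c x y * phi (br x y) + om x y = 0.

Definition brel x y v := act x (act y v)
  = act y (act x v) + c x y *: act (br x y) v + om x y *: v.

Lemma brel_sym x y v : brel x y v -> brel y x v.
Proof.
rewrite /brel => ->.
by rewrite (cN x) (omN x) (brC y) !scaleNr addrAC !addrK.
Qed.

Lemma brel_supported (p : pred (word X)) x y v :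
  (forall w, p w -> brel x y (mon (spell w))) -> supported p v -> brel x y v.
Proof.
move=> pxy; apply: (@supported_ind _ _ _ p (brel x y)); rewrite /brel.
- by rewrite !linear0 ?scaler0 !addr0.
- move=> a u w hu hw; rewrite !linearP /= hu hw.
  by apply: coefP => k; rewrite !coef_linE; ring.
- by move=> w pw; rewrite mon_spell; apply: pxy.
Qed.

(* If one of the letters is small on [s], the larger one is pushed past the
   smaller one by the very definition of the action. *)
Lemma brel_small x i y s : index x = Some i -> sorted pleq (i :: s) ->
  brel x y (mon s).
Proof.
wlog yi : x i y / ~~ small y (i :: s).
  move=> IH xi si; have [|yi] := boolP (small y (i :: s)); last exact: IH xi si.
  rewrite /small; case yj : (index y) => [j|//] /= /andP[ji js].
  have sj : sorted pleq (j :: s).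
    by rewrite sorted_cons_all js; case/andP: (etrans (esym (sorted_cons_all _ _)) si).
  have [eij|nij] := eqVneq i j.
    rewrite -(indexK xi) -(indexK yj) eij /brel c_diag om_diag.
    by rewrite !scale0r !addr0.
  apply: brel_sym; apply: (IH y j x) => //.
  rewrite /small xi /= negb_and; apply/orP; left; apply: contra nij => ij.
  by apply/eqP/pleq_anti; rewrite ij.
move=> xi si; have is_ : all (pleq i) s by move: si; rewrite sorted_cons_all => /andP[].
apply: brel_sym; rewrite /brel (act_small xi is_) act_big //.
by rewrite (indexK xi).
Qed.

(* The minimal letter [i] of the word is pulled out of both sides; the Jacobi
   identity and the induction hypothesis on shorter words conclude. *)
Lemma brel_mon x y s : sorted pleq s -> brel x y (mon s).
Proof.
have [n] := ubnP (size s); elim: n x y s => // n IHn x y s.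
rewrite ltnS => sn ss.
have {IHn}IH x' y' v : supported (fun w => (size (spell w) < size s)%N) v -> brel x' y' v.
  apply: brel_supported => w ws; apply: IHn; last exact: spellP w.
  exact: leq_trans ws sn.
have [|xs] := boolP (small x s).
  rewrite /small; case xi : (index x) => [i|//] is_.
  by apply: (brel_small _ xi); rewrite sorted_cons_all is_.
have [|ys] := boolP (small y s).
  rewrite /small; case yi : (index y) => [i|//] is_; apply: brel_sym.
  by apply: (brel_small _ yi); rewrite sorted_cons_all is_.
case: s sn ss xs ys IH => [|i t] sn ss xs ys IH.
  have {}xs : index x = None by move: xs; rewrite /small; case: (index x).
  have {}ys : index y = None by move: ys; rewrite /small; case: (index y).
  rewrite /brel !act_base ?sub_br // !linearZ /= !act_base //.
  have -> : om x y = - (c x y * phi (br x y)).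
    by apply/eqP; rewrite -addr_eq0 addrC phi_hom.
  by apply: coefP => k; rewrite !coef_linE; ring.
have /andP[it st] : all (pleq i) t && sorted pleq t by rewrite -sorted_cons_all.
set z := letter i in xs ys *.
have IHt x' y' : brel x' y' (mon t).
  by apply: IH; apply: mon_supported; rewrite (perm_size (perm_spell_to_word t)).
have zt : act z (mon t) = mon (i :: t) by apply: act_letter.
have step x' y' : ~~ small x' (i :: t) -> ~~ small y' (i :: t) ->
    act x' (act y' (mon (i :: t))) = act z (act x' (act y' (mon t)))
      + c x' z *: act (br x' z) (act y' (mon t)) + om x' z *: act y' (mon t)
      + c y' z *: act x' (act (br y' z) (mon t)) + om y' z *: act x' (mon t).
  move=> x's y's; rewrite act_big // !linearD !linearZ /= -/z.
  apply: (congr2 +%R) => //; apply: (congr2 +%R) => //.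
  suff : brel x' z (act y' (mon t)) by [].
  (* The leading monomial [j :: t] is as long as [i :: t], hence out of reach of [IH]. But [i] is at
     most each of its letters, so [brel_small] covers it, and [IH] covers the shorter remainder. *)
  rewrite -(subrK (ins y' t) (act y' (mon t))) addrC.
  have brelD u v : brel x' z u -> brel x' z v -> brel x' z (u + v).
    rewrite /brel !linearD /= => -> ->.
    by apply: coefP => k; rewrite !coef_linE; ring.
  apply: brelD; last first.
    by apply: IH; apply: (supportedW _ (act_low (x := y') st)) => w; rewrite /len_le /= ltnS.
  rewrite /ins; case y'j : (index y') => [j|]; last first.
    by rewrite /brel !linear0 ?scaler0 !addr0.
  have ij : pleq i j.
    case/orP: (pleq_total i j) => // ji; case/negP: y's.
    by rewrite /small y'j /= ji; apply: sub_all it => k; apply: pleq_trans.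
  have -> : mon (j :: t) = mon (sort pleq (j :: t)).
    by apply: mon_perm; rewrite perm_sym perm_sort.
  apply: brel_sym; apply: (brel_small _ (letterK i)).
  rewrite sorted_cons_all sort_sorted ?andbT; last exact: pleq_total.
  by rewrite (perm_all _ (introT permPl (perm_sort _ _))) /= ij.
rewrite /brel !step // -zt (IHt (br x y) z) (IHt x y) (IHt x (br y z)) (IHt (br x z) y).
have -> : br (br x z) y = br (br x y) z by rewrite -brA (brC z) brA.
rewrite brA !linearD !linearZ /=.
rewrite !scalerA ![_ * c x y]mulrC -c_jacobi -om_jacobi.
by apply: coefP => k; rewrite !coef_linE; ring.
Qed.

Lemma act_rel x y v :
  act x (act y v) = act y (act x v) + c x y *: act (br x y) v + om x y *: v.
Proof.
apply: (@brel_supported predT) => // w _; apply: brel_mon; exact: spellP w.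
Qed.

(** * Universal property of the induced module *)

Section Evaluation.
Variables (M : lmodType K) (op : G -> {linear M -> M}) (m0 : M).

Definition word_op s := foldr (fun i => op (letter i)) m0 s.

(** Asked on the vectors [word_op s] only: central elements act by the prescribed scalars on what
    [m0] generates, not on all of [M]. *)
Hypothesis op_rel : forall x y s, op x (op y (word_op s)) =
  op y (op x (word_op s)) + c x y *: op (br x y) (word_op s) + om x y *: word_op s.
Hypothesis op_base : forall x, index x = None -> op x m0 = phi x *: m0.

Definition eval v : M := linext (fun w : word X => word_op (spell w)) v.

Lemma eval_linear : linear eval.
Proof. exact: linext_linear. Qed.
HB.instance Definition _ :=
  GRing.isLinear.Build K S M *:%R eval eval_linear.

Lemma eval_mon s : sorted pleq s -> eval (mon s) = word_op s.
Proof. by move=> ss; rewrite /eval linext_gen spell_to_word. Qed.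

(** Follows the recursion behind [act]: each of its steps is a bracket relation or a value of [phi],
    and [op] respects both. *)
Lemma eval_act x v : eval (act x v) = op x (eval v).
Proof.
have supp_eval (p : pred (word X)) y u :
    (forall w, p w -> eval (act y (mon (spell w))) = op y (eval (mon (spell w)))) ->
    supported p u -> eval (act y u) = op y (eval u).
  move=> pe; apply: (@supported_ind _ _ _ p (fun u => eval (act y u) = op y (eval u))).
  - by rewrite !linear0.
  - by move=> a u1 u2 e1 e2; rewrite !linearP /= e1 e2.
  - by move=> w /pe; rewrite mon_spell.
apply: (supp_eval predT) => // w _; have := spellP w.
have [n] := ubnP (size (spell w)); elim: n x (spell w) => // n IHn x s sn ss.
have [|xs] := boolP (small x s).
  rewrite /small; case xi : (index x) => [i|//] is_.
  have si : sorted pleq (i :: s) by rewrite sorted_cons_all is_.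
  by rewrite (act_small xi is_) !eval_mon //= (indexK xi).
case: s sn ss xs => [|i t] sn ss xs.
  have xN : index x = None by move: xs; rewrite /small; case: (index x).
  by rewrite act_base // linearZ /= eval_mon //= op_base.
have /andP[it st] : all (pleq i) t && sorted pleq t by rewrite -sorted_cons_all.
have IH y : eval (act y (mon t)) = op y (word_op t).
  by rewrite IHn ?eval_mon.
rewrite act_big // !linearD !linearZ /= IH eval_mon // (eval_mon ss) /= op_rel.
apply: (congr2 +%R) => //; apply: (congr2 +%R) => //.
rewrite -IH; move: (act_low (x := x) st) (esym (subrK (ins x t) (act x (mon t)))).
move: (_ - _) => u lu ->; rewrite !linearD /=; apply: (congr2 +%R).
  apply: (supp_eval _ _ _ _ lu) => w' tw.
  by apply: IHn; [apply: leq_ltn_trans tw _|exact: spellP w'].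
rewrite /ins; case xj : (index x) => [j|]; last by rewrite !linear0.
have ij : pleq i j.
  case/orP: (pleq_total i j) => // ji; case/negP: xs.
  by rewrite /small xj /= ji; apply: sub_all it => k; apply: pleq_trans.
have -> : mon (j :: t) = mon (sort pleq (j :: t)).
  by apply: mon_perm; rewrite perm_sym perm_sort.
have sjt : sorted pleq (sort pleq (j :: t)) by apply: sort_sorted; apply: pleq_total.
have sijt : sorted pleq (i :: sort pleq (j :: t)).
  rewrite sorted_cons_all sjt andbT.
  by rewrite (perm_all _ (introT permPl (perm_sort _ _))) /= ij.
by rewrite act_letter // !eval_mon.
Qed.

Lemma eval_unique (g : S -> M) : linear g -> (forall x v, g (act x v) = op x (g v)) ->
  g (mon [::]) = m0 -> forall v, g v = eval v.
Proof.
move=> g_lin g_act g0; pose gL := GRing.isLinear.Build K S M *:%R g g_lin.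
pose g' : {linear S -> M} := HB.pack g gL.
apply: free_ind => [|a u w gu gw|w].
- by rewrite linear0; apply: (linear0 g').
- by rewrite g_lin gu gw linearP.
rewrite mon_spell eval_mon ?(spellP w) //; have := spellP w.
elim: (spell w) => [//|i t IH] it; rewrite -act_letter // g_act IH //.
exact: path_sorted it.
Qed.
End Evaluation.

(** * Weight filtration and leading terms *)

Section Weights.
Variable wt : X -> nat.
Hypothesis wt_gt0 : forall i, (0 < wt i)%N.

Definition weight s := \sum_(i <- s) wt i.
Definition gwt x := if index x is Some i then wt i else 0%N.

(** A bracket of two letters must be strictly lighter than their product, whereas a subalgebra
    element may preserve the weight, as its scalar [phi x] does; hence the extra unit. *)
Hypothesis wt_br : forall x i, c x (letter i) != 0 ->
  (gwt (br x (letter i)) < gwt x + wt i + (index x == None))%N.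

Lemma gwt_letter i : gwt (letter i) = wt i.
Proof. by rewrite /gwt letterK. Qed.

Definition wt_lt n : pred (word X) := fun w => (weight (spell w) < n)%N.

Lemma weight_cons i s : weight (i :: s) = (wt i + weight s)%N.
Proof. exact: big_cons. Qed.

Lemma weight_cat s t : weight (s ++ t) = (weight s + weight t)%N.
Proof. exact: big_cat. Qed.

Lemma weight_perm s t : perm_eq s t -> weight s = weight t.
Proof. exact: perm_big. Qed.

Lemma weight_eq0 s : weight s = 0%N -> s = [::].
Proof.
by case: s => // i s /eqP; rewrite weight_cons addn_eq0 eqn0Ngt wt_gt0.
Qed.

Lemma weight_rem i s : i \in s -> (weight (rem i s) + wt i)%N = weight s.
Proof. by move=> /perm_to_rem/weight_perm->; rewrite weight_cons addnC. Qed.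

Lemma mon_weight s n : (weight s < n)%N -> supported (wt_lt n) (mon s).
Proof.
by move=> sn; apply: mon_supported; rewrite /wt_lt (weight_perm (perm_spell_to_word s)).
Qed.

Lemma supported_leq m n v : (m <= n)%N -> supported (wt_lt m) v -> supported (wt_lt n) v.
Proof. by move=> mn; apply: supportedW => w /leq_trans; apply. Qed.

Lemma act_leading x s : supported (wt_lt (gwt x + weight s + (index x == None)))
  (act x (mon s) - ins x s).
Proof.
wlog ss : s / sorted pleq s.
  have ps : perm_eq s (sort pleq s) by rewrite perm_sym perm_sort.
  move=> /(_ (sort pleq s)); rewrite -(mon_perm K ps) -(ins_perm _ ps) -(weight_perm ps).
  by apply; apply: sort_sorted; apply: pleq_total.
have [n] := ubnP (size s); elim: n x s ss => // n IHn x s ss sn.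
have [|xs] := boolP (small x s).
  rewrite /small; case xi : (index x) => [i|//] is_.
  by rewrite (act_small xi is_) /ins xi subrr; apply: supported0.
case: s ss sn xs => [|i t] ss sn xs.
  have xN : index x = None by move: xs; rewrite /small; case: (index x).
  rewrite act_base // /ins xN subr0 /gwt xN; apply: supportedZ.
  by apply: mon_weight; rewrite /weight big_nil.
have /andP[it st] : all (pleq i) t && sorted pleq t by rewrite -sorted_cons_all.
have act_leW y (r : seq X) : sorted pleq r -> (size r < n)%N ->
    supported (wt_lt (gwt y + weight r).+1) (act y (mon r)).
  move=> sk kn; rewrite -(subrK (ins y r) (act y (mon r))).
  apply: supportedD.
    by apply: supported_leq (IHn y r sk kn); rewrite -addn1 leq_add2l; case: eqP.
  rewrite /ins /gwt; case: (index y) => [j|]; last exact: supported0.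
  by apply: mon_weight; rewrite weight_cons.
rewrite act_big // -(small_ins ss xs).
have ut := IHn x t st sn; have lt := act_low (x := x) st.
have := esym (subrK (ins x t) (act x (mon t))); move: (_ - _) ut lt => u ut lt ->.
have -> : act (letter i) (u + ins x t) + c x (letter i) *: act (br x (letter i)) (mon t)
    + om x (letter i) *: mon t - act (letter i) (ins x t)
  = act (letter i) u + c x (letter i) *: act (br x (letter i)) (mon t)
    + om x (letter i) *: mon t.
  by rewrite linearD /=; apply: coefP => k; rewrite !coef_linE; ring.
rewrite weight_cons; apply: supportedD; first apply: supportedD.
(* The length is kept next to the weight because the bound on [act (letter i)] comes from the
   induction on length. *)
- pose p : pred (word X) := fun w =>
    (weight (spell w) < gwt x + weight t + (index x == None))%N && (size (spell w) <= size t)%N.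
  apply: (@supported_linear _ _ _ p); last first.
    by move=> w wu; apply/andP; split; [exact: ut w wu|exact: lt w wu].
  move=> w /andP[w1 w2]; rewrite mon_spell.
  apply: supported_leq (act_leW _ _ (spellP w) (leq_ltn_trans w2 sn)).
  by rewrite gwt_letter [(gwt x + (_ + _))%N]addnCA -addnA ltn_add2l.
- have [->|c0] := eqVneq (c x (letter i)) 0; first by rewrite scale0r; apply: supported0.
  apply: supportedZ; apply: supported_leq (act_leW _ _ st sn).
  by have := wt_br c0; lia.
- apply: supportedZ; apply: mon_weight.
  by have := wt_gt0 i; lia.
Qed.

Lemma act_letter_leading i s :
  supported (wt_lt (wt i + weight s)) (act (letter i) (mon s) - mon (i :: s)).
Proof. by have := @act_leading (letter i) s; rewrite gwt_letter /ins letterK addn0. Qed.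

Lemma act_letter_lt i n v :
  supported (wt_lt n) v -> supported (wt_lt (wt i + n)) (act (letter i) v).
Proof.
apply: supported_linear => w wn; rewrite mon_spell /=.
rewrite -(subrK (mon (i :: spell w)) (act _ _)); apply: supportedD.
  by apply: supported_leq (@act_letter_leading _ _); move: wn; rewrite /wt_lt; lia.
apply: mon_weight; rewrite weight_cons.
by move: wn; rewrite /wt_lt; lia.
Qed.

Lemma top_word v : v != 0 ->
  exists w, coef w v != 0 /\ supported (wt_lt (weight (spell w)).+1) v.
Proof.
move=> v0; have [r rP] := finite_support v.
have argmax (r' : seq (word X)) : {in r', forall w, coef w v = 0} \/
    exists w, coef w v != 0 /\ {in r', forall w', coef w' v != 0 ->
      (weight (spell w') <= weight (spell w))%N}.
  elim: r' => [|w r' [r'0|[w1 [w1v w1P]]]]; first by left.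
    have [w0|wv] := eqVneq (coef w v) 0.
      by left => w'; rewrite inE => /orP[/eqP->|/r'0].
    right; exists w; split=> // w'; rewrite inE => /orP[/eqP->//|/r'0->].
    by rewrite eqxx.
  right; have [w0|wv] := eqVneq (coef w v) 0.
    exists w1; split=> // w'; rewrite inE => /orP[/eqP->|/w1P//].
    by rewrite w0 eqxx.
  have [ww1|/ltnW w1w] := leqP (weight (spell w)) (weight (spell w1)).
    by exists w1; split=> // w'; rewrite inE => /orP[/eqP->|/w1P].
  exists w; split=> // w'; rewrite inE => /orP[/eqP->//|/w1P w1' /w1' h].
  exact: leq_trans h w1w.
case: (argmax r) => [r0|[w [wv wP]]]; last first.
  by exists w; split=> // w' w'v; apply: wP => //; apply: rP.
case/eqP: v0; apply: coef_eq0 => k; apply/eqP/contraT => kv.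
by move: (kv); rewrite (r0 k (rP k kv)) eqxx.
Qed.

(** * Endomorphisms that raise the weight *)

Section Raising.
Variables (f : S -> S) (a : K) (t : seq X).
Hypotheses (f_lin : linear f) (f_act : forall x v, f (act x v) = act x (f v)).
Hypothesis f_leading : supported (wt_lt (weight t)) (f (mon [::]) - a *: mon t).

Lemma raise_leading s :
  supported (wt_lt (weight s + weight t)) (f (mon s) - a *: mon (s ++ t)).
Proof.
wlog ss : s / sorted pleq s.
  have ps : perm_eq s (sort pleq s) by rewrite perm_sym perm_sort.
  move=> /(_ (sort pleq s)); rewrite -(mon_perm K ps) -(weight_perm ps).
  rewrite (@mon_perm K _ (sort _ _ ++ t) (s ++ t)); last by rewrite perm_cat2r perm_sort.
  by apply; apply: sort_sorted; apply: pleq_total.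
elim: s ss => [|i s IH] ss; first by rewrite /weight big_nil.
have {}IH := IH (path_sorted ss).
rewrite -act_letter // f_act weight_cons cat_cons.
have -> : act (letter i) (f (mon s)) - a *: mon (i :: s ++ t) =
    act (letter i) (f (mon s) - a *: mon (s ++ t))
    + a *: (act (letter i) (mon (s ++ t)) - mon (i :: s ++ t)).
  by rewrite linearB /= actZ; apply: coefP => k; rewrite !coef_linE; ring.
apply: supportedD; first by rewrite -addnA; apply: act_letter_lt.
apply: supportedZ; apply: supported_leq (@act_letter_leading _ _).
by rewrite weight_cat addnA.
Qed.

(** A heaviest word [w] of [v] reappears in [f v] as [w ++ t], with its coefficient multiplied by
    [a], and [w ++ t] is not empty. *)
Lemma raise_neq v : a != 0 -> t != [::] -> f v <> mon [::].
Proof.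
move=> a0 t0 fv; have f0 : f 0 = 0.
  by have := f_lin (-1) 0 0; rewrite scaler0 addr0 scaleN1r addNr.
have mon0 : mon [::] <> 0 :> S.
  move=> /(congr1 (coef (to_word [::]))); rewrite coef_mon fm_coef0 /=.
  by move/eqP; rewrite oner_eq0.
have v0 : v != 0 by apply/eqP => v0; apply: mon0; rewrite -fv v0.
have [w [wv wP]] := top_word v0.
have : coef (to_word (spell w ++ t)) (f v) = a * coef w v.
  apply: (@supported_ind _ _ _ _ (fun u => coef (to_word (spell w ++ t)) (f u) = a * coef w u) _ _ _ _ wP).
  - by rewrite f0 !fm_coef0 mulr0.
  - by move=> b u1 u2 e1 e2; rewrite f_lin !coef_linE e1 e2; ring.
  move=> k kw; rewrite mon_spell -(subrK (a *: mon (spell k ++ t)) (f _)) fm_coefD.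
  have -> : coef (to_word (spell w ++ t)) (f (mon (spell k)) - a *: mon (spell k ++ t)) = 0.
    apply/eqP/contraT => /(raise_leading); rewrite /wt_lt.
    rewrite (weight_perm (perm_spell_to_word _)) weight_cat ltn_add2r.
    by move: kw; rewrite /wt_lt ltnS leqNgt => /negbTE->.
  rewrite add0r fm_coefZ !coef_mon; congr (_ * (nat_of_bool _)%:R).
  by rewrite (permPr (perm_spell_to_word _)) perm_cat2r.
rewrite fv coef_mon (permPr (perm_spell_to_word _)) => /esym/eqP.
have -> : perm_eq [::] (spell w ++ t) = false.
  apply/negP => /perm_size/=/esym/eqP; rewrite size_cat addn_eq0 !size_eq0.
  by rewrite (negbTE t0) andbF.
by rewrite mulf_eq0 (negbTE a0) (negbTE wv).
Qed.
End Raising.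

(** * Subalgebra elements as approximate partial derivatives *)

Section Lowering.
Variables (tgt : G -> option X) (kap : G -> K).

(* Up to lower weight, [x - phi x] acts on monomials as [kap x] times the partial
   derivative in the letter [tgt x]; this is [lowering x]. *)
Definition drop_wt x := if tgt x is Some i then wt i else 0%N.
Definition lowering x s : S :=
  if tgt x is Some i then (kap x * (count_mem i s)%:R) *: mon (rem i s) else 0.

(** The bracket of [x] with a letter can contribute a new letter, the lowering of a subalgebra
    element, or a scalar. The first two must lose more than [drop_wt x]; the scalar either does so
    too or is exactly the coefficient of the derivative. *)
Hypothesis drop_letter : forall x i j, index x = None -> c x (letter i) != 0 ->
  index (br x (letter i)) = Some j -> (drop_wt x + wt j < wt i)%N.
Hypothesis drop_sub : forall x i, index x = None -> c x (letter i) != 0 ->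
  index (br x (letter i)) = None -> (drop_wt x < drop_wt (br x (letter i)) + wt i)%N.
Hypothesis drop_scalar : forall x i, index x = None ->
  (drop_wt x < wt i)%N \/
  (if index (br x (letter i)) is None then c x (letter i) * phi (br x (letter i)) else 0)
    + om x (letter i) = (if tgt x == Some i then kap x else 0).

(** With [n = weight s], these are the words lighter than the monomials of [lowering x s], that is,
    the error terms. *)
Definition drops x n : pred (word X) := fun w => (weight (spell w) + drop_wt x < n)%N.

Lemma mon_drops x n s : (weight s + drop_wt x < n)%N -> supported (drops x n) (mon s).
Proof.
by move=> sn; apply: mon_supported; rewrite /drops (weight_perm (perm_spell_to_word s)).
Qed.

Lemma lowering_supported x s :
  supported (fun w => weight (spell w) + drop_wt x <= weight s)%N (lowering x s).
Proof.
rewrite /lowering /drop_wt; case: (tgt x) => [i|]; last exact: supported0.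
have [is_|nis] := boolP (i \in s).
  apply: supportedZ; apply: mon_supported.
  by rewrite (weight_perm (perm_spell_to_word _)) weight_rem.
by rewrite (count_memPn nis) mulr0 scale0r; apply: supported0.
Qed.

(** The Leibniz rule for the derivative in the letter [tgt x]. *)
Lemma lowering_cons x i s :
  lowering x (i :: s) = (if tgt x == Some i then kap x else 0) *: mon s
  + if tgt x is Some j then (kap x * (count_mem j s)%:R) *: mon (i :: rem j s) else 0.
Proof.
rewrite /lowering; case: (tgt x) => [j|]; last by rewrite scale0r addr0.
rewrite (inj_eq Some_inj) /= (eq_sym i); have [->|ji] := eqVneq j i; last first.
  by rewrite scale0r add0r add0n.
have [is_|nis] := boolP (i \in s); last first.
  by rewrite (count_memPn nis) addn0 mulr1 mulr0 scale0r addr0.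
rewrite -(mon_perm K (perm_to_rem is_)) -scalerDl; congr (_ *: _).
by rewrite natrD mulrDr mulr1.
Qed.

Lemma act_sub_lowering x s : index x = None ->
  supported (drops x (weight s)) (act x (mon s) - phi x *: mon s - lowering x s).
Proof.
wlog ss : s / sorted pleq s.
  have ps : perm_eq s (sort pleq s) by rewrite perm_sym perm_sort.
  move=> /(_ (sort pleq s)); rewrite -(mon_perm K ps) -(weight_perm ps).
  have -> : lowering x s = lowering x (sort pleq s).
    rewrite /lowering; case: (tgt x) => // i.
    rewrite (permP ps) (@mon_perm K _ (rem i s) (rem i (sort pleq s))) //.
    have [is_|nis] := boolP (i \in s).
      rewrite -(perm_cons i) -(permPl (perm_to_rem is_)) (permPl ps).
      by apply: perm_to_rem; rewrite -(perm_mem ps).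
    by rewrite !rem_id // -(perm_mem ps).
  by apply; apply: sort_sorted; apply: pleq_total.
elim: s x ss => [|i t IH] x ss xN.
  rewrite act_base // subrr sub0r /lowering; case: (tgt x) => [j|].
    by rewrite mulr0 scale0r oppr0; apply: supported0.
  by rewrite oppr0; apply: supported0.
have st := path_sorted ss; set z := letter i.
(* Moving [x] past [z] splits the error in four: the previous error under [z], the reordering of [z]
   with the lowered monomials, the bracket without its scalar, and the discrepancy between that
   scalar and the derivative coefficient. *)
have -> : act x (mon (i :: t)) - phi x *: mon (i :: t) - lowering x (i :: t) =
    act z (act x (mon t) - phi x *: mon t - lowering x t)
  + (act z (lowering x t)
     - if tgt x is Some j then (kap x * (count_mem j t)%:R) *: mon (i :: rem j t) else 0)
  + c x z *: (act (br x z) (mon t)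
       - if index (br x z) is None then phi (br x z) *: mon t else 0)
  + ((if index (br x z) is None then c x z * phi (br x z) else 0) + om x z
     - if tgt x == Some i then kap x else 0) *: mon t.
  rewrite lowering_cons act_big ?/small ?xN // !linearB /= actZ act_letter // -/z.
  by apply: coefP => k; case: (index (br x z)) => [j|]; rewrite !coef_linE; ring.
rewrite weight_cons.
have low_z u : supported (drops x (weight t)) u ->
    supported (drops x (wt i + weight t)) (act z u).
  apply: supported_linear => w wt_; rewrite mon_spell /=.
  apply: supportedW (@act_letter_lt i _ _ (mon_weight (ltnSn (weight (spell w))))).
  by move=> k; move: wt_; rewrite /wt_lt /drops; lia.
apply: supportedD; first apply: supportedD; first apply: supportedD.
- exact/low_z/IH.
- rewrite /lowering /drops /drop_wt; case: (tgt x) => [j|]; last first.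
    by rewrite linear0 subrr; apply: supported0.
  rewrite actZ -scalerBr; have [jt|njt] := boolP (j \in t); last first.
    by rewrite (count_memPn njt) mulr0 scale0r; apply: supported0.
  apply: supportedZ; apply: (supportedW _ (@act_letter_leading _ _)) => w.
  by rewrite /wt_lt -(weight_rem jt); lia.
- have [->|c0] := eqVneq (c x z) 0; first by rewrite scale0r; apply: supported0.
  apply: supportedZ; case bj : (index (br x z)) => [j|].
    have lt := drop_letter xN c0 bj; rewrite subr0 -(indexK bj).
    apply: supportedW (@act_letter_lt j _ _ (mon_weight (ltnSn (weight t)))).
    by move=> w; rewrite /wt_lt /drops; lia.
  have := drop_sub xN c0 bj; rewrite -/z => lt.
  rewrite -(subrK (lowering (br x z) t) (_ - _)); apply: supportedD.
    by apply: supportedW (IH _ st bj) => w; rewrite /drops; lia.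
  by apply: supportedW (@lowering_supported _ _) => w; rewrite /drops; lia.
have [lt|->] := drop_scalar i xN; last by rewrite subrr scale0r; apply: supported0.
by apply: supportedZ; apply: mon_drops; rewrite addnC ltn_add2r.
Qed.

Hypothesis tgt_onto : forall i, exists x, [/\ index x = None, tgt x = Some i & kap x != 0].
Hypothesis char0 : [pchar K] =i pred0.

(** [act x - phi x], with [x] chosen to lower the first letter of a heaviest word, removes that
    letter. The new coefficient is the old one times [kap x] and the multiplicity of the letter,
    nonzero in characteristic 0. *)
Lemma lower_to_unit (P : S -> Prop) v : v != 0 -> P v ->
  (forall a u1 u2, P u1 -> P u2 -> P (a *: u1 + u2)) ->
  (forall x u, P u -> P (act x u)) -> P (mon [::]).
Proof.
move=> v0 Pv PD Pact; have [w [wv wP]] := top_word v0.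
have [n] := ubnP (weight (spell w)); elim: n v w v0 Pv wv wP => // n IHn v w v0 Pv wv wP wn.
case ws : (spell w) => [|i t].
  have -> : mon [::] = (coef w v)^-1 *: v + 0.
    rewrite addr0 -[mon _]scale1r -(mulVf wv) -scalerA.
    congr (_ *: _); apply: coefP => k; rewrite fm_coefZ coef_mon.
    have [kv|kv] := eqVneq (coef k v) 0.
      rewrite kv; have [kw|] := boolP (perm_eq _ _); last by rewrite mulr0.
      have ekw : k = w by apply: spell_inj; rewrite ws; apply/nilP; rewrite /nilp -(perm_size kw).
      by rewrite -ekw kv mul0r.
    have /weight_eq0 k0 : weight (spell k) = 0%N.
      by apply/eqP; have := wP k kv; rewrite /wt_lt ws /weight big_nil ltnS leqn0.
    by rewrite k0 perm_refl mulr1; congr (coef _ v); apply: spell_inj; rewrite ws k0.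
  have P0 := PD (-1) v v Pv Pv; rewrite scaleN1r addNr in P0.
  exact: PD.
have [x [xN xi kx]] := tgt_onto i.
pose A u := act x u - phi x *: u.
have A_lin a u1 u2 : A (a *: u1 + u2) = a *: A u1 + A u2.
  by rewrite /A linearP /=; apply: coefP => k; rewrite !coef_linE; ring.
have ws_wt : weight (spell w) = (wt i + weight t)%N by rewrite ws weight_cons.
have drop_x : drop_wt x = wt i by rewrite /drop_wt xi.
have A_mon r : A (mon r) = lowering x r + (act x (mon r) - phi x *: mon r - lowering x r).
  by rewrite addrC subrK.
have A_lt : supported (wt_lt (weight t).+1) (A v).
  apply: (@supported_ind _ _ _ _ (fun u => supported (wt_lt (weight t).+1) (A u)) _ _ _ _ wP).
  - by rewrite /A linear0 scaler0 subr0; apply: supported0.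
  - move=> a u1 u2 h1 h2; rewrite A_lin; apply: supportedD => //; exact: supportedZ.
  move=> k kw; rewrite mon_spell A_mon; apply: supportedD.
    apply: (supportedW _ (@lowering_supported _ _)) => w'.
    by move: kw; rewrite /wt_lt ws_wt drop_x; lia.
  apply: (supportedW _ (act_sub_lowering xN)) => w'.
  by move: kw; rewrite /wt_lt /drops ws_wt drop_x; lia.
(* No cancellation can occur: the error terms are lighter than [t], and removing [i] from a word
   gives [t] only if that word is [w]. *)
have A_coef : coef (to_word t) (A v) = coef w v * (kap x * (count_mem i (i :: t))%:R).
  apply: (@supported_ind _ _ _ _ (fun u => coef (to_word t) (A u)
     = coef w u * (kap x * (count_mem i (i :: t))%:R)) _ _ _ _ wP).
  - by rewrite /A linear0 scaler0 subr0 !fm_coef0 mul0r.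
  - by move=> a u1 u2 h1 h2; rewrite A_lin (fm_coefD _ (a *: A u1)) fm_coefZ h1 h2 !coef_linE; ring.
  move=> k kw; rewrite mon_spell A_mon fm_coefD.
  have -> : coef (to_word t) (act x (mon (spell k)) - phi x *: mon (spell k) - lowering x (spell k)) = 0.
    apply/eqP/contraT => /(act_sub_lowering xN); rewrite /drops drop_x.
    rewrite (weight_perm (perm_spell_to_word _)); move: kw; rewrite /wt_lt ws_wt; lia.
  rewrite addr0 /lowering xi fm_coefZ !coef_mon (permPr (perm_spell_to_word _)) ws.
  have [ik|nik] := boolP (i \in spell k); last first.
    rewrite (count_memPn nik) mulr0 mul0r.
    have -> : perm_eq (spell k) (i :: t) = false.
      by apply/negP => /perm_mem/(_ i); rewrite (negbTE nik) mem_head.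
    by rewrite mul0r.
  rewrite -(perm_cons i) -(permPl (perm_to_rem ik)).
  by have [/permP->|] := boolP (perm_eq _ _); rewrite ?mulr1 ?mul1r ?mulr0 ?mul0r.
have Av : coef (to_word t) (A v) != 0.
  rewrite A_coef !mulf_neq0 // /= eqxx add1n; have := char0; rewrite pcharf0P => -> //.
apply: (IHn (A v) (to_word t)) => //.
- by apply/eqP => Av0; rewrite Av0 fm_coef0 eqxx in Av.
- by rewrite /A addrC -scaleNr; apply: PD => //; apply: Pact.
- by rewrite (weight_perm (perm_spell_to_word t)).
- rewrite (weight_perm (perm_spell_to_word t)); move: wn; rewrite ws_wt.
  by have := wt_gt0 i; lia.
Qed.
End Lowering.
End Weights.

End InducedModule.

(** * Structure constants and weights of the Lie algebra [L] *)

Section StructureConstants.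
Variables (K : fieldType) (m : nat) (phD phI : int -> K) (p1 p2 : K).
Hypothesis m_gt0 : (0 < m)%N.

(* [(true, n)] stands for [d_n] and [(false, n)] for [I_n]; the complement letters
   [(true, k)] and [(false, k)] stand for [d_(m-1-k)] and [I_(-1-k)]. *)
Definition gap (t : bool) : int := if t then m%:Z else 0.

Definition wletter (i : bool * nat) : bool * int := (i.1, gap i.1 + Negz i.2).
Definition windex (x : bool * int) : option (bool * nat) :=
  if x.2 - gap x.1 is Negz k then Some (x.1, k) else None.

Definition wbr (x y : bool * int) : bool * int := (x.1 && y.1, y.2 + x.2).

Definition wc (x y : bool * int) : K :=
  match x.1, y.1 with
  | true, true => (y.2 - x.2)%:~R
  | true, false => y.2%:~R
  | false, true => - x.2%:~R
  | false, false => 0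
  end.

Definition om_dd (n k : int) : K :=
  if n == - k then ((n ^+ 3 - n)%:~R / 12%:R) * p1 else 0.
Definition om_dI (n k : int) : K :=
  if n == - k then (n ^+ 2 + n)%:~R * p2 else 0.

Definition wom (x y : bool * int) : K :=
  match x.1, y.1 with
  | true, true => om_dd x.2 y.2
  | true, false => om_dI x.2 y.2
  | false, true => - om_dI y.2 x.2
  | false, false => 0
  end.

Definition wphi (x : bool * int) : K := if x.1 then phD x.2 else phI x.2.

Lemma windex_ge x : windex x = None <-> gap x.1 <= x.2.
Proof.
rewrite /windex -subr_ge0; case e : (x.2 - gap x.1) => [k|k]; split=> //.
Qed.

Lemma wletterK i : windex (wletter i) = Some i.
Proof. by case: i => t k; rewrite /windex /wletter /= addrC addKr. Qed.

Lemma windexK x i : windex x = Some i -> wletter i = x.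
Proof.
case: x => t n; rewrite /windex /wletter /=; case e : (n - gap t) => [k|k] // [<-] /=.
by rewrite -e addrC subrK.
Qed.

Lemma wcN x y : wc y x = - wc x y.
Proof. by rewrite /wc; case: x.1 y.1 => [] []; rewrite ?opprK ?oppr0 -?rmorphN ?opprB. Qed.

Lemma om_ddN n k : om_dd k n = - om_dd n k.
Proof.
rewrite /om_dd -eqr_oppLR (eq_sym (- k)); case: eqP => [->|]; last by rewrite oppr0.
by ring.
Qed.

Lemma womN x y : wom y x = - wom x y.
Proof.
by rewrite /wom; case: x.1 y.1 => [] []; rewrite ?opprK ?oppr0 // om_ddN.
Qed.

Lemma wc_diag x : wc x x = 0.
Proof. by rewrite /wc; case: x.1; rewrite ?subrr. Qed.

Lemma wom_diag x : wom x x = 0.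
Proof.
rewrite /wom /om_dd; case: x.1 => //; case: eqP => // e.
have -> : x.2 = 0 by lia.
by rewrite expr0n subrr mulr0z !mul0r.
Qed.

Lemma wbrC x y : wbr x y = wbr y x.
Proof. by rewrite /wbr andbC addrC. Qed.

Lemma wbrA x y z : wbr x (wbr y z) = wbr (wbr x y) z.
Proof. by rewrite /wbr /= andbA addrA. Qed.

Lemma wc_jacobi x y z :
  wc x z * wc (wbr x z) y + wc y z * wc x (wbr y z) = wc x y * wc (wbr x y) z.
Proof.
by case: x y z => [[] a] [[] b] [[] d]; rewrite /wc /=; ring.
Qed.

Lemma wom_jacobi x y z :
  wc x z * wom (wbr x z) y + wc y z * wom x (wbr y z) = wc x y * wom (wbr x y) z.
Proof.
case: x y z => [xt a] [yt b] [zt d].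
rewrite /wc /wom /om_dd /om_dI /=.
(* Central terms occur in total degree zero only, so the six tests are one and the same equation. *)
have -> : (d + a == - b) = (a + b + d == 0) by lia.
have -> : (b == - (d + a)) = (a + b + d == 0) by lia.
have -> : (a == - (d + b)) = (a + b + d == 0) by lia.
have -> : (d + b == - a) = (a + b + d == 0) by lia.
have -> : (b + a == - d) = (a + b + d == 0) by lia.
have -> : (d == - (b + a)) = (a + b + d == 0) by lia.
have [e|ne] := eqVneq (a + b + d) 0; last first.
  by case: xt yt zt => [] [] []; rewrite /= ?oppr0 ?mulr0 ?addr0.
have -> : d = - (a + b) by lia.
by case: xt yt zt => [] [] []; rewrite /=; ring.
Qed.

Hypothesis hDD : forall a b : int, m%:Z <= a -> m%:Z <= b ->
  (b - a)%:~R * phD (b + a) + om_dd a b = 0.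
Hypothesis hDI : forall a b : int, m%:Z <= a -> 0 <= b ->
  b%:~R * phI (b + a) + om_dI a b = 0.

Lemma wsub_br x y : windex x = None -> windex y = None -> windex (wbr x y) = None.
Proof.
rewrite !windex_ge /wbr; case: x y => [[] a] [[] b] /=; lia.
Qed.

Lemma wphi_hom x y : windex x = None -> windex y = None ->
  wc x y * wphi (wbr x y) + wom x y = 0.
Proof.
rewrite !windex_ge /wbr /wc /wom /wphi; case: x y => [[] a] [[] b] /= ha hb.
- exact: hDD.
- exact: hDI.
- by apply/eqP; rewrite -oppr_eq0 opprD mulNr !opprK addrC -(hDI hb ha) addrC (addrC b).
- by rewrite mul0r addr0.
Qed.

(* The weight of [I_(-j)] is [2j + 1] and that of [d_(m-k)] is [4k + 2m + 2]. The
   slopes make brackets lower weights; the constants make [d_(m-1)] heavier than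
   [I_(-1) I_(-m)], itself heavier than [I_(-m-1)]. *)
Definition wwt (i : bool * nat) : nat :=
  if i.1 then (4 * i.2.+1 + 2 * m + 2)%N else (2 * i.2.+1 + 1)%N.

Lemma wwt_gt0 i : (0 < wwt i)%N.
Proof. by rewrite /wwt; case: i.1; lia. Qed.

Lemma wgwtE x : (gwt windex wwt x)%:Z =
  if x.2 < gap x.1 then if x.1 then 4 * (m%:Z - x.2) + 2 * m%:Z + 2 else - (2 * x.2) + 1
  else 0.
Proof.
case: x => t n; rewrite /gwt /windex /wwt /gap /=.
case e : (n - _) => [k|k] /=; case: t e => e; case: ifP; lia.
Qed.

Lemma windex_NoneE x : (windex x == None) = (gap x.1 <= x.2).
Proof. by apply/eqP/idP => /windex_ge. Qed.

Lemma wwt_br x i : wc x (wletter i) != 0 ->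
  (gwt windex wwt (wbr x (wletter i)) < gwt windex wwt x + wwt i + (windex x == None))%N.
Proof.
have wi : wwt i = gwt windex wwt (wletter i) by rewrite /gwt wletterK.
rewrite wi windex_NoneE.
have := wgwtE x; have := wgwtE (wletter i); have := wgwtE (wbr x (wletter i)).
have : (wletter i).2 < gap (wletter i).1 by case: i {wi} => [t k]; rewrite /wletter /=; lia.
move: (wletter i) (gwt _ _ _) (gwt _ _ _) (gwt _ _ _) => y A B C.
case: x y => [[] a] [[] b]; rewrite /wc /wbr /gap /= ?eqxx // => lb EA EB EC _;
  by move: EA EB EC; do 3 case: ifP; lia.
Qed.

Hypothesis char0 : [pchar K] =i pred0.

Lemma intr_neq0 (n : int) : n != 0 -> n%:~R != 0 :> K.
Proof.
have nz k : k%:R == 0 :> K = (k == 0%N) by have/pcharf0P := char0; apply.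
by case: n => k; rewrite ?NegzE ?rmorphN ?oppr_eq0 /= -pmulrn nz.
Qed.

(** [[d_m, I_(k-m)] = (k-m) I_k] is a bracket in the subalgebra without central term. *)
Lemma phI_top k : m%:Z < k -> phI k = 0.
Proof.
move=> mk; have := hDI (lexx m%:Z) (b := k - m%:Z).
rewrite /om_dI subrK; have -> : (m%:Z == - (k - m%:Z)) = false by lia.
rewrite addr0 => /(_ _)/eqP; rewrite mulf_eq0 (negbTE (intr_neq0 _)) /=; last lia.
by move=> h; apply/eqP/h; lia.
Qed.

(** Here [[d_m, d_(k-m)] = (k-2m) d_k]. The coefficient vanishes at [k = 2m], so [phD (2m)] remains
    free. *)
Lemma phD_top k : 2 * m%:Z < k -> phD k = 0.
Proof.
move=> mk; have := hDD (lexx m%:Z) (b := k - m%:Z).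
rewrite /om_dd subrK; have -> : (m%:Z == - (k - m%:Z)) = false by lia.
rewrite addr0 => /(_ _)/eqP; rewrite mulf_eq0 (negbTE (intr_neq0 _)) /=; last lia.
by move=> h; apply/eqP/h; lia.
Qed.

(* [I_K] lowers [d_(m-K)] and [d_(m+J)] lowers [I_(-J)]; [I_0] and [d_m] lower
   nothing. *)
Definition wtgt (x : bool * int) : option (bool * nat) :=
  if x.2 - gap x.1 is Posz k.+1 then Some (~~ x.1, k) else None.
Definition wkap (x : bool * int) : K := - (x.2 - gap x.1)%:~R * phI m%:Z.

Lemma wdropE x : gap x.1 <= x.2 -> (drop_wt wwt wtgt x)%:Z =
  if x.2 == gap x.1 then 0 else if x.1 then 2 * (x.2 - m%:Z) + 1
  else 4 * x.2 + 2 * m%:Z + 2.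
Proof.
case: x => t n; rewrite /drop_wt /wtgt /wwt /gap /=.
by case: t => /=; case e : (n - _) => [[|k]|k] /= h; case: ifP; lia.
Qed.

Lemma wdrop_letter x i j : windex x = None -> wc x (wletter i) != 0 ->
  windex (wbr x (wletter i)) = Some j -> (drop_wt wwt wtgt x + wwt j < wwt i)%N.
Proof.
move=> /windex_ge xN c0 bj.
have -> : wwt i = gwt windex wwt (wletter i) by rewrite /gwt wletterK.
have -> : wwt j = gwt windex wwt (wbr x (wletter i)) by rewrite /gwt bj.
have lb : (wletter i).2 < gap (wletter i).1 by case: i {c0 bj} => [t k]; rewrite /wletter /=; lia.
have lbr : (wbr x (wletter i)).2 < gap (wbr x (wletter i)).1.
  by rewrite ltNge; apply/negP => /windex_ge; rewrite bj.
have := wdropE xN; have := wgwtE (wletter i); have := wgwtE (wbr x (wletter i)).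
rewrite lb lbr; move: (wletter i) (drop_wt _ _ _) (gwt _ _ _) (gwt _ _ _) c0 lb lbr xN.
move=> y A B C; case: x y {bj} => [[] a] [[] b]; rewrite /wc /wbr /gap /= ?eqxx // => c0 lb lbr xN;
  by case: ifP; lia.
Qed.

Lemma wdrop_sub x i : windex x = None -> wc x (wletter i) != 0 ->
  windex (wbr x (wletter i)) = None ->
  (drop_wt wwt wtgt x < drop_wt wwt wtgt (wbr x (wletter i)) + wwt i)%N.
Proof.
move=> /windex_ge xN c0 /windex_ge bN.
have -> : wwt i = gwt windex wwt (wletter i) by rewrite /gwt wletterK.
have lb : (wletter i).2 < gap (wletter i).1 by case: i {c0 bN} => [t k]; rewrite /wletter /=; lia.
have := wdropE xN; have := wdropE bN; have := wgwtE (wletter i).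
rewrite lb; move: (wletter i) (drop_wt _ _ _) (drop_wt _ _ _) (gwt _ _ _) c0 lb bN xN.
move=> y A B C; case: x y => [[] a] [[] b]; rewrite /wc /wbr /gap /= ?eqxx // => c0 lb bN xN;
  by do 2 case: ifP; lia.
Qed.

Lemma wtgtP x i : windex x = None -> (wtgt x == Some i) =
  (i.1 == ~~ x.1) && (x.2 - gap x.1 == i.2.+1%:Z).
Proof.
move=> /windex_ge; case: x i => [t n] [u k]; rewrite /wtgt /=.
case e : (n - gap t) => [[|l]|l] h /=; first by case: (u == ~~ t).
  rewrite (inj_eq Some_inj) xpair_eqE (eq_sym u) eqz_nat eqSS; by [].
lia.
Qed.

(** Once [x] drops at least the weight of [i], a bracket of two [d] has degree above [2m], where
    [phD] vanishes, and a bracket of a [d] with an [I] has degree at least [m], where only [I_m] can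
    survive. Degree exactly [m] occurs for the target letter of [x] alone. *)
Lemma wdrop_scalar x i : windex x = None -> (drop_wt wwt wtgt x < wwt i)%N \/
  (if windex (wbr x (wletter i)) is None
   then wc x (wletter i) * wphi (wbr x (wletter i)) else 0) + wom x (wletter i)
  = (if wtgt x == Some i then wkap x else 0).
Proof.
move=> xN; have [|le] := ltnP (drop_wt wwt wtgt x) (wwt i); [by left|right].
rewrite (wtgtP _ xN).
have wi : wwt i = gwt windex wwt (wletter i) by rewrite /gwt wletterK.
have i0 := wwt_gt0 i.
move/windex_ge: xN => xN; move: le (wdropE xN) (wgwtE (wletter i)); rewrite -wi.
have lb : (wletter i).2 < gap (wletter i).1 by case: i {wi i0} => [t k]; rewrite /wletter /=; lia.
rewrite lb; have [_|a0] := eqVneq x.2 (gap x.1).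
  by move: (drop_wt _ _ _) (wwt i) i0 => A B; lia.
have hit : (i.1 == ~~ x.1) && (x.2 - gap x.1 == i.2.+1)
    = ((wletter i).1 == ~~ x.1) && (gap x.1 - x.2 == (wletter i).2 - gap (wletter i).1).
  by case: i {wi i0 lb} => t k; rewrite /wletter /= NegzE; congr (_ && _); lia.
have bN : gap (wbr x (wletter i)).1 <= (wbr x (wletter i)).2 ->
    windex (wbr x (wletter i)) = None by move/windex_ge.
rewrite {}hit; move: (drop_wt _ _ _) (wwt i) (wletter i) lb bN {wi i0} => A B y.
case: x y xN a0 => [[] a] [[] b]; rewrite /wkap /wbr /wc /wom /wphi /om_dd /om_dI /gap /=.
- move=> am ne lb bN BA EA EB; rewrite bN; last by lia.
  rewrite phD_top; last by lia.
  have -> : (a == - b) = false by lia.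
  by rewrite mulr0 addr0.
- move=> am ne lb bN BA EA EB; rewrite bN; last by lia.
  have -> : (a == - b) = false by lia.
  rewrite addr0; case: eqP => [e|ne'].
    have -> : b + a = m%:Z by lia.
    have -> : b = - (a - m%:Z) by lia.
    by rewrite rmorphN.
  by rewrite phI_top ?mulr0 //; lia.
- move=> am ne lb bN BA EA EB; rewrite bN; last by lia.
  have -> : (b == - a) = false by lia.
  rewrite oppr0 addr0; case: eqP => [e|ne'].
    have -> : b + a = m%:Z by lia.
    by rewrite subr0.
  by rewrite phI_top ?mulr0 //; lia.
- by move=> _ _ _ _ _ _ _; case: (windex _) => *; rewrite ?mul0r addr0.
Qed.

(** This is where [phi I_m <> 0] enters: otherwise every [wkap] would be zero. *)
Lemma wtgt_onto : phI m%:Z != 0 ->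
  forall i, exists x, [/\ windex x = None, wtgt x = Some i & wkap x != 0].
Proof.
move=> Im [t k]; exists (~~ t, gap (~~ t) + k.+1%:Z).
have e : gap (~~ t) + k.+1%:Z - gap (~~ t) = k.+1 by rewrite addrC addKr.
split; first by apply/windex_ge; rewrite /= lerDl.
  by rewrite /wtgt /= e negbK.
by rewrite /wkap /= e mulf_neq0 // oppr_eq0 intr_neq0.
Qed.

(** * The action of [L] and deviations from the Whittaker condition *)

Local Notation S := (free_module_on K (word (bool * nat)%type)).
Local Notation mon := (@mon K (bool * nat)%type).
Local Notation wact := (act wletter windex wc wom wbr wphi).
Implicit Types (u v : S) (x y : bool * int).

Lemma wact_rel x y v :
  wact x (wact y v) = wact y (wact x v) + wc x y *: wact (wbr x y) v + wom x y *: v.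
Proof.
exact: (act_rel wletterK windexK wcN womN wc_diag wom_diag wbrC wbrA
  wc_jacobi wom_jacobi wsub_br wphi_hom).
Qed.

Lemma wact_unit x : windex x = None -> wact x (mon [::]) = wphi x *: mon [::].
Proof. exact: act_base. Qed.

(* A vector is a Whittaker vector when its deviation under every subalgebra
   element vanishes. *)
Definition dev x v : S := wact x v - wphi x *: v.

Lemma dev_linear x a u v : dev x (a *: u + v) = a *: dev x u + dev x v.
Proof. by rewrite /dev linearP /=; apply: coefP => k; rewrite !coef_linE; ring. Qed.

Lemma dev_act x y v :
  dev x (wact y v) = wact y (dev x v) + wc x y *: wact (wbr x y) v + wom x y *: v.
Proof.
rewrite /dev wact_rel linearB /= actZ.
by apply: coefP => k; rewrite !coef_linE; ring.
Qed.

Lemma dev_unit x : windex x = None -> dev x (mon [::]) = 0.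
Proof. by move=> xN; rewrite /dev wact_unit // subrr. Qed.

Lemma dev_act_unit x y : windex x = None -> dev x (wact y (mon [::])) =
  wc x y *: wact (wbr x y) (mon [::]) + wom x y *: mon [::].
Proof. by move=> xN; rewrite dev_act dev_unit // linear0 add0r. Qed.

(** The [I] commute, because [z_3] acts by zero. *)
Lemma dev_II k n v : dev (false, k) v = 0 -> dev (false, k) (wact (false, n) v) = 0.
Proof.
by move=> kv; rewrite dev_act kv linear0 /wc /wom /= !scale0r !addr0.
Qed.

Lemma dev_dI n k : m%:Z <= n -> dev (true, n) (wact (false, k) (mon [::])) =
  k%:~R *: wact (false, k + n) (mon [::]) + om_dI n k *: mon [::].
Proof. by move=> mn; rewrite dev_act_unit //; apply/windex_ge. Qed.

Lemma dev_dI_scalar n k : m%:Z <= n -> 0 <= k + n ->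
  dev (true, n) (wact (false, k) (mon [::])) =
  (k%:~R * phI (k + n) + om_dI n k) *: mon [::].
Proof.
move=> mn kn; rewrite dev_dI // wact_unit; last exact/windex_ge.
by rewrite scalerA -scalerDl.
Qed.

(** * A second Whittaker vector when [phi I_m = 0] *)

Section TopVanishes.
Hypothesis phI_m : phI m%:Z = 0.

(** The bracket is [-k I_(m-1+k)]: its coefficient vanishes for [k = 0], it is a multiple of [I_m]
    for [k = 1], and it lies above [I_m] afterwards. *)
Lemma dev_Id k : 0 <= k -> dev (false, k) (wact (true, m%:Z - 1) (mon [::])) = 0.
Proof.
move=> k0; rewrite dev_act_unit; last exact/windex_ge.
rewrite /wc /wom /wbr /om_dI /=.
have [->|kn] := eqVneq k 0.
  (* For [m = 1] the central condition does hold here, but [n^2 + n] is zero at [n = 0]. *)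
  rewrite oppr0 scale0r add0r; case: eqP => [e|_]; last by rewrite oppr0 scale0r.
  by rewrite e expr0n addr0 mulr0z mul0r oppr0 scale0r.
rewrite wact_unit; last by apply/windex_ge; rewrite /=; lia.
rewrite /wphi /=; have -> : phI (m%:Z - 1 + k) = 0.
  have [e|ne] := eqVneq (m%:Z - 1 + k) m%:Z; first by rewrite e.
  by apply: phI_top; lia.
rewrite scale0r scaler0 add0r; have -> : (m%:Z - 1 == - k) = false by lia.
by rewrite oppr0 scale0r.
Qed.

(** Can be nonzero only for [n = m] and [n = m + 1], since [phD] vanishes above [2m]. *)
Lemma dev_dd n : m%:Z <= n -> dev (true, n) (wact (true, m%:Z - 1) (mon [::])) =
  ((m%:Z - 1 - n)%:~R * phD (m%:Z - 1 + n)) *: mon [::].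
Proof.
move=> mn; rewrite dev_act_unit; last exact/windex_ge.
rewrite /wc /wom /wbr /om_dd /= wact_unit; last by apply/windex_ge; rewrite /=; lia.
have -> : (n == - (m%:Z - 1)) = false by lia.
by rewrite scale0r addr0 scalerA.
Qed.

Definition whittaker u := forall x, windex x = None -> dev x u = 0.

Lemma whittakerP u : (forall k, 0 <= k -> dev (false, k) u = 0) ->
  dev (true, m%:Z) u = 0 -> dev (true, m%:Z + 1) u = 0 ->
  (forall n, m%:Z + 1 < n -> dev (true, n) u = 0) -> whittaker u.
Proof.
move=> uI um um1 un [[] n] /windex_ge /= mn; last exact: uI.
have [->//|nm] := eqVneq n m%:Z; have [->//|nm1] := eqVneq n (m%:Z + 1).
by apply: un; lia.
Qed.

(* The two coefficients are determined by cancelling the deviations of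
   [d_(m-1) w] under [d_m] and [d_(m+1)]. *)
Lemma whittaker_combine v1 v2 (s1 s2 s12 : K) : s1 != 0 -> s2 != 0 ->
  (forall k, 0 <= k -> dev (false, k) v1 = 0) ->
  (forall k, 0 <= k -> dev (false, k) v2 = 0) ->
  dev (true, m%:Z) v1 = s1 *: mon [::] ->
  (forall n, m%:Z < n -> dev (true, n) v1 = 0) ->
  dev (true, m%:Z) v2 = s12 *: mon [::] ->
  dev (true, m%:Z + 1) v2 = s2 *: mon [::] ->
  (forall n, m%:Z + 1 < n -> dev (true, n) v2 = 0) ->
  exists a1 a2,
    whittaker (a2 *: v2 + (a1 *: v1 + wact (true, m%:Z - 1) (mon [::]))).
Proof.
move=> s10 s20 I1 I2 m1 n1 m2 m12 n2.
(* The system is triangular: [d_(m+1)] sees only [v2], which fixes [a2], with the factor 2 coming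
   from [(m-1) - (m+1)]; then [a1] also absorbs the part [s12] of [v2] under [d_m]. *)
pose a2 := 2%:R * phD (2 * m%:Z) / s2; pose a1 := (phD (2 * m%:Z - 1) - a2 * s12) / s1.
exists a1, a2; apply: whittakerP => [k k0|||n mn]; rewrite !dev_linear.
- by rewrite I1 // I2 // dev_Id // !scaler0 !addr0.
- rewrite m1 m2 dev_dd // !scalerA -!scalerDl.
  have -> : m%:Z - 1 + m%:Z = 2 * m%:Z - 1 by lia.
  have -> : m%:Z - 1 - m%:Z = -1 by lia.
  by rewrite divfK // (_ : _ + _ = 0) ?scale0r //; ring.
- rewrite n1 ?m12 ?dev_dd; try lia.
  rewrite scaler0 add0r scalerA -scalerDl.
  have -> : m%:Z - 1 + (m%:Z + 1) = 2 * m%:Z by lia.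
  have -> : m%:Z - 1 - (m%:Z + 1) = -2 by lia.
  by rewrite divfK // (_ : _ + _ = 0) ?scale0r //; ring.
- rewrite n1 ?n2 ?dev_dd; try lia.
  by rewrite phD_top ?mulr0 ?scale0r ?scaler0 ?addr0 //; lia.
Qed.

Local Notation wlt := (wt_lt wwt).
Local Notation wgt := (weight wwt).

Lemma wact_I (j : nat) : wact (false, Negz j) (mon [::]) = mon [:: (false, j)].
Proof.
have -> : (false, Negz j) = wletter (false, j) by rewrite /wletter /= add0r.
by apply: (act_letter wc wom wbr wphi wletterK (i := (false, j)) (s := [::])).
Qed.

Lemma wact_d : wact (true, m%:Z - 1) (mon [::]) = mon [:: (true, 0%N)].
Proof. by apply: (act_letter wc wom wbr wphi wletterK (i := (true, 0%N)) (s := [::])). Qed.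

Lemma wact_II (j : nat) s :
  supported (wlt (wgt ((false, j) :: s))) (wact (false, Negz j) (mon s) - mon ((false, j) :: s)).
Proof.
have -> : (false, Negz j) = wletter (false, j) by rewrite /wletter /= add0r.
rewrite weight_cons.
exact: (act_letter_leading wletterK wwt_gt0 wwt_br).
Qed.

Lemma wact_II_leading (a : K) (i j : nat) v :
  supported (wlt (wgt [:: (false, i); (false, j)])) v ->
  supported (wlt (wgt [:: (false, i); (false, j)]))
    (v + a *: wact (false, Negz i) (wact (false, Negz j) (mon [::]))
      - a *: mon [:: (false, i); (false, j)]).
Proof.
move=> vl; rewrite -addrA -scalerBr; apply: supportedD => //.
by apply: supportedZ; rewrite wact_I; apply: wact_II.
Qed.

Lemma mon1_lt i n : (wwt i < n)%N -> supported (wlt n) (mon [:: i]).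
Proof. by move=> lt; apply: mon_weight; rewrite weight_cons /weight big_nil addn0. Qed.

(* A Whittaker vector which is not a multiple of the generator: its leading
   monomial [t] is not the unit. *)
Definition nonscalar_whittaker :=
  exists u (a : K) (t : seq (bool * nat)), [/\ whittaker u, a != 0, t != [::]
    & supported (wlt (wgt t)) (u - a *: mon t)].

(** The monomial of [d_(m-1)] outweighs both corrections, so it leads whatever [a1] and [a2] are. *)
Lemma nonscalar_combine v1 v2 a1 a2 : supported (wlt (wwt (true, 0%N))) v1 ->
  supported (wlt (wwt (true, 0%N))) v2 ->
  whittaker (a2 *: v2 + (a1 *: v1 + wact (true, m%:Z - 1) (mon [::]))) ->
  nonscalar_whittaker.
Proof.
move=> l1 l2 uW; exists (a2 *: v2 + (a1 *: v1 + wact (true, m%:Z - 1) (mon [::]))), 1.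
exists [:: (true, 0%N)]; split=> //; first exact: oner_neq0.
rewrite scale1r wact_d weight_cons /weight big_nil addn0 addrA addrK.
by apply: supportedD; apply: supportedZ.
Qed.

(* With [I_r] the last nonvanishing character value, [I_(-(m-r))] and
   [I_(-(m+1-r))] correct [d_(m-1)]. *)
Lemma nonscalar_positive_top r : (0 < r < m)%N -> phI r%:Z != 0 ->
  (forall k, r%:Z < k -> phI k = 0) -> nonscalar_whittaker.
Proof.
case/andP=> r0 rm phr phk.
have I0 n k : 0 <= k -> dev (false, k) (wact (false, n) (mon [::])) = 0.
  by move=> k0; apply: dev_II; apply: dev_unit; apply/windex_ge.
(* [Negz] shifts by one: these are [I_(-(m+1-r))] and [I_(-(m-r))]. [d_(m+1)] moves the first to
   [I_r], [d_m] moves the second there, and larger [d_n] move both beyond. *)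
have [a1 [a2]] : exists a1 a2, whittaker (a2 *: wact (false, Negz (m - r)) (mon [::]) +
    (a1 *: wact (false, Negz (m - r).-1) (mon [::]) + wact (true, m%:Z - 1) (mon [::]))).
  (* The central term [om_dI] in the last scalar can be nonzero only if [r = 1], when [m + 1 - r]
     equals [m]. *)
  apply: (@whittaker_combine _ _ ((Negz (m - r).-1)%:~R * phI r%:Z) ((Negz (m - r))%:~R * phI r%:Z)
      ((Negz (m - r))%:~R * phI (r%:Z - 1) + om_dI m%:Z (Negz (m - r)))).
  - by rewrite mulf_neq0 // intr_neq0.
  - by rewrite mulf_neq0 // intr_neq0.
  - by move=> k k0; apply: I0.
  - by move=> k k0; apply: I0.
  - rewrite dev_dI_scalar; try lia.
    have -> : Negz (m - r).-1 + m%:Z = r%:Z by lia.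
    rewrite /om_dI; have -> : (m%:Z == - Negz (m - r).-1) = false by lia.
    by rewrite addr0.
  - move=> n mn; rewrite dev_dI_scalar; try lia.
    rewrite phk; last by lia.
    rewrite /om_dI; have -> : (n == - Negz (m - r).-1) = false by lia.
    by rewrite mulr0 addr0 scale0r.
  - rewrite dev_dI_scalar; try lia.
    by have -> : Negz (m - r) + m%:Z = r%:Z - 1 by lia.
  - rewrite dev_dI_scalar; try lia.
    have -> : Negz (m - r) + (m%:Z + 1) = r%:Z by lia.
    rewrite /om_dI; have -> : (m%:Z + 1 == - Negz (m - r)) = false by lia.
    by rewrite addr0.
  - move=> n mn; rewrite dev_dI_scalar; try lia.
    rewrite phk; last by lia.
    rewrite /om_dI; have -> : (n == - Negz (m - r)) = false by lia.
    by rewrite mulr0 addr0 scale0r.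
apply: nonscalar_combine; rewrite wact_I; apply: mon1_lt; rewrite /wwt /=; lia.
Qed.

Section ZeroTop.
Hypothesis phk : forall k : int, 0 < k -> phI k = 0.
(* The deviation of [I_(-n) w] under [d_n] is [lam n w]. When [lam m] or [lam (m+1)] vanishes, the
   correction of [d_(m-1) w] can break down, but then [I_(-m) w], respectively
   [I_(-(m+1)) w] corrected by a multiple of [I_(-1) I_(-m) w], is itself a
   Whittaker vector. *)
Definition lam (n : int) : K := n%:~R * ((n + 1)%:~R * p2 - phI 0).
Local Notation mon0 := (mon [::]).
Local Notation vI n := (wact (false, - n) mon0).

Lemma dev_I_vI n k : 0 <= k -> dev (false, k) (vI n) = 0.
Proof. by move=> k0; apply: dev_II; apply: dev_unit; apply/windex_ge. Qed.

Lemma dev_d_vI n : m%:Z <= n -> dev (true, n) (vI n) = lam n *: mon0.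
Proof.
move=> mn; rewrite dev_dI_scalar // ?addNr // /om_dI opprK eqxx /lam.
by congr (_ *: _); ring.
Qed.

Lemma dev_d_vI_lt n k : m%:Z <= n -> k < n -> dev (true, n) (vI k) = 0.
Proof.
move=> mn kn; rewrite dev_dI_scalar ?phk; try lia.
rewrite /om_dI opprK; have -> : (n == k) = false by lia.
by rewrite mulr0 addr0 scale0r.
Qed.

Local Notation vII := (wact (false, -1) (vI m%:Z)).

Lemma dev_I_vII k : 0 <= k -> dev (false, k) vII = 0.
Proof. by move=> k0; apply: dev_II; apply: dev_I_vI. Qed.

Lemma dev_d_vII_lt n : m%:Z < n -> dev (true, n) vII = 0.
Proof.
move=> mn; rewrite dev_act dev_d_vI_lt //; last by lia.
rewrite linear0 add0r /wc /wom /wbr /om_dI /=.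
have -> : (n == - -1) = false by lia.
have := dev_I_vI m%:Z (k := - 1 + n); rewrite /dev /wphi /= phk; last by lia.
rewrite !scale0r subr0 => ->; last by lia.
by rewrite scaler0 addr0.
Qed.

(** For [m = 1] the two factors of [I_(-1) I_(-m)] coincide and each contributes [lam 1] under
    [d_m]. For [m > 1] only [I_(-m)] contributes, since [phi I_(m-1) = 0]. *)
Definition vII_coef : K := if m == 1%N then 2%:R * lam 1 else lam m%:Z.

Lemma dev_m_vII : dev (true, m%:Z) vII = vII_coef *: vI 1.
Proof.
rewrite dev_act dev_d_vI // actZ /wc /wom /wbr /om_dI /vII_coef /= opprK.
have := dev_I_vI m%:Z (k := - 1 + m%:Z); rewrite /dev /wphi /= => /(_ _)/eqP.
rewrite subr_eq0 => h; have {h} -> := eqP (h _); last by lia.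
case: (eqVneq m 1%N) => [e|m1]; last first.
  have -> : (m%:Z == 1) = false by lia.
  by rewrite phk ?scale0r ?scaler0 ?addr0 //; lia.
have -> : (m%:Z == 1) = true by lia.
have -> : m%:Z = 1 by lia.
have -> : -1 + 1 = 0 :> int by [].
rewrite scalerA -!scalerDl /lam; congr (_ *: _); ring.
Qed.

Lemma nonscalar_zero_top : nonscalar_whittaker.
Proof.
have vIE (j : nat) : wact (false, - (j.+1)%:Z) mon0 = mon [:: (false, j)].
  by rewrite -NegzE wact_I.
have m_pred : m = m.-1.+1 by rewrite prednK.
have vm : vI m%:Z = mon [:: (false, m.-1)] by rewrite [in LHS]m_pred vIE.
have [lm0|lm] := eqVneq (lam m%:Z) 0.
  exists (vI m%:Z), 1, [:: (false, m.-1)]; split => //; first 1 last.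
  - exact: oner_neq0.
  - by rewrite scale1r vm subrr; apply: supported0.
  apply: whittakerP => [k k0|||n mn]; first exact: dev_I_vI.
  - by rewrite dev_d_vI // lm0 scale0r.
  - by rewrite dev_d_vI_lt //; lia.
  - by rewrite dev_d_vI_lt //; lia.
have c0 : vII_coef != 0.
  rewrite /vII_coef; case: (eqVneq m 1%N) => [e|_ //]; rewrite mulf_neq0 //.
    exact: (intr_neq0 (n := 2)).
  by move: lm; rewrite e.
(* Under [d_m], [I_(-(m+1)) w] deviates by [-(m+1) I_(-1) w], which is no multiple of [w]; [b]
   cancels it against the deviation of [I_(-1) I_(-m) w]. *)
pose b := (m%:Z + 1)%:~R / vII_coef.
have b0 : b != 0 by rewrite mulf_neq0 ?invr_eq0 // intr_neq0 //; lia.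
pose Y := b *: vII + vI (m%:Z + 1).
have YI k : 0 <= k -> dev (false, k) Y = 0.
  by move=> k0; rewrite dev_linear dev_I_vII // dev_I_vI // scaler0 addr0.
have Ym : dev (true, m%:Z) Y = 0.
  rewrite dev_linear dev_m_vII dev_dI // /om_dI.
  have -> : (m%:Z == - - (m%:Z + 1)) = false by lia.
  have -> : - (m%:Z + 1) + m%:Z = -1 by lia.
  rewrite scale0r addr0 scalerA -scalerDl divfK // rmorphN subrr scale0r.
  by [].
have Ym1 : dev (true, m%:Z + 1) Y = lam (m%:Z + 1) *: mon0.
  by rewrite dev_linear dev_d_vII_lt ?dev_d_vI ?scaler0 ?add0r //; lia.
have Yn n : m%:Z + 1 < n -> dev (true, n) Y = 0.
  by move=> mn; rewrite dev_linear dev_d_vII_lt ?dev_d_vI_lt ?scaler0 ?add0r //; lia.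
have vm1 : vI (m%:Z + 1) = mon [:: (false, m)].
  by rewrite (_ : m%:Z + 1 = m.+1) ?vIE //; lia.
have Y_leading : supported (wlt (wgt [:: (false, 0%N); (false, m.-1)]))
    (Y - b *: mon [:: (false, 0%N); (false, m.-1)]).
  have -> : Y = vI (m%:Z + 1)
      + b *: wact (false, Negz 0) (wact (false, Negz m.-1) mon0).
    by rewrite /Y addrC [in LHS](_ : - m%:Z = Negz m.-1) //; lia.
  apply: wact_II_leading; rewrite vm1; apply: mon1_lt.
  by rewrite !weight_cons /weight big_nil /wwt /=; lia.
have [lm10|lm1] := eqVneq (lam (m%:Z + 1)) 0.
  exists Y, b, [:: (false, 0%N); (false, m.-1)]; split => //.
  by apply: whittakerP => //; rewrite Ym1 lm10 scale0r.
have [a1 [a2 uW]] : exists a1 a2,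
    whittaker (a2 *: Y + (a1 *: vI m%:Z + wact (true, m%:Z - 1) mon0)).
  apply: (@whittaker_combine _ _ (lam m%:Z) (lam (m%:Z + 1)) 0) => //.
  - by move=> k; apply: dev_I_vI.
  - exact: dev_d_vI.
  - by move=> n mn; rewrite dev_d_vI_lt //; lia.
  - by rewrite Ym scale0r.
apply: nonscalar_combine uW.
  by rewrite vm; apply: mon1_lt; rewrite /wwt /=; lia.
rewrite -(subrK (b *: mon [:: (false, 0%N); (false, m.-1)]) Y); apply: supportedD.
  apply: supported_leq Y_leading; rewrite !weight_cons /weight big_nil /wwt /=; lia.
apply/supportedZ/mon_weight; rewrite !weight_cons /weight big_nil /wwt /=; lia.
Qed.

End ZeroTop.

Lemma nonscalar_whittaker_exists : nonscalar_whittaker.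
Proof.
have vanish k : m%:Z <= k -> phI k = 0.
  by rewrite le_eqVlt => /orP[/eqP<-//|/phI_top].
have top n : (forall k : int, n%:Z < k -> phI k = 0) -> (forall k : int, 0 < k -> phI k = 0) \/
    exists r : nat, [/\ (0 < r)%N, phI r%:Z != 0 & forall k, r%:Z < k -> phI k = 0].
  elim: n => [|n IHn] nk; first by left.
  have [p0|pn] := eqVneq (phI n.+1%:Z) 0; last by right; exists n.+1.
  apply: IHn => k nlt; have [->//|ne] := eqVneq k n.+1%:Z.
  by apply: nk; lia.
case: (top m) => [k /ltW/vanish//|phk|[r [r0 pr pk]]]; first exact: nonscalar_zero_top.
apply: (nonscalar_positive_top (r := r)) => //; rewrite r0 ltnNge /=; apply/negP => mr.
by move: pr; rewrite vanish ?eqxx //; lia.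
Qed.
End TopVanishes.

Lemma wact_simple (P : S -> Prop) v : phI m%:Z != 0 -> v != 0 -> P v ->
  (forall (a : K) u1 u2, P u1 -> P u2 -> P (a *: u1 + u2)) ->
  (forall x u, P u -> P (wact x u)) -> forall u, P u.
Proof.
move=> Im v0 Pv PD Pact.
have Punit : P (mon [::]).
  exact: (lower_to_unit wletterK windexK wwt_gt0 wwt_br wdrop_letter wdrop_sub
    wdrop_scalar (wtgt_onto Im) char0 v0 Pv PD Pact).
have P0 := PD (-1) v v Pv Pv; rewrite scaleN1r addNr in P0.
apply: free_ind => // w; rewrite mon_spell; have := spellP w.
elim: (spell w) => // i t IH it.
by rewrite -(act_letter wc wom wbr wphi wletterK it); apply/Pact/IH/(path_sorted it).
Qed.

Lemma wact_raise (f : S -> S) (a : K) t : linear f ->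
  (forall x v, f (wact x v) = wact x (f v)) -> a != 0 -> t != [::] ->
  supported (wt_lt wwt (weight wwt t)) (f (mon [::]) - a *: mon t) ->
  forall v, f v <> mon [::].
Proof.
move=> f_lin f_act a0 t0 lead v.
exact: (raise_neq wletterK wwt_gt0 wwt_br f_lin f_act lead a0 t0).
Qed.

Lemma unit_neq0 : mon [::] != 0.
Proof.
apply/eqP => /(congr1 (coef (to_word [::]))); rewrite coef_mon fm_coef0 /=.
by move/eqP; rewrite oner_eq0.
Qed.

End StructureConstants.

(** * Simplicity does not depend on the choice of universal module *)

Section Transfer.
Variables (V V' : lmodType CC) (rho : Lrep V) (rho' : Lrep V').

Lemma Lhom_id : Lhom rho rho id.
Proof. by do !split. Qed.

Lemma Lhom_comp (V'' : lmodType CC) (rho'' : Lrep V'') f g :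
  Lhom rho rho' f -> Lhom rho' rho'' g -> Lhom rho rho'' (g \o f).
Proof.
move=> [fl [fd [fI [f1 [f2 f3]]]]] [gl [gd [gI [g1 [g2 g3]]]]].
split; first by move=> a u v; rewrite /= fl gl.
by do !split; move=> * /=; rewrite ?fd ?gd ?fI ?gI ?f1 ?g1 ?f2 ?g2 ?f3 ?g3.
Qed.

Lemma Lhom0 f : Lhom rho rho' f -> f 0 = 0.
Proof. by case=> fl _; have := fl (-1) 0 0; rewrite scaler0 addr0 scaleN1r addNr. Qed.

Lemma simple_transfer f g : Lhom rho rho' f -> cancel f g -> cancel g f ->
  simple_module rho -> simple_module rho'.
Proof.
move=> fh fg gf [[v v0] simp]; have f0 := Lhom0 fh.
case: (fh) => fl [fd [fI [f1 [f2 f3]]]].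
split.
  exists (f v); apply: contraNneq v0 => fv; rewrite -(fg v) fv -f0 fg.
  by [].
move=> P [P0 [PD [PZ [Pd [PI [P1 [P2 P3]]]]]]].
have fD u w : f (u + w) = f u + f w by have := fl 1 u w; rewrite !scale1r.
have fZ a u : f (a *: u) = a *: f u by have := fl a u 0; rewrite f0 !addr0.
case: (simp (fun v => P (f v))).
- split; first by rewrite f0.
  split; first by move=> u w Pu Pw; rewrite fD; apply: PD.
  split; first by move=> a u Pu; rewrite fZ; apply: PZ.
  split; first by move=> n u Pu; rewrite fd; apply: Pd.
  split; first by move=> n u Pu; rewrite fI; apply: PI.
  split; first by move=> u Pu; rewrite f1; apply: P1.
  by split=> u Pu; rewrite ?f2 ?f3; [apply: P2|apply: P3].
- by move=> h; left => u Pu; rewrite -(gf u) (h (g u)) ?gf.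
- by move=> h; right => u; rewrite -(gf u); apply: h.
Qed.
End Transfer.

Lemma universal_iso m phD phI p1 p2 p3 (V V' : lmodType CC) (rho : Lrep V)
    (rho' : Lrep V') w w' :
  universal_whittaker m phD phI p1 p2 p3 rho w ->
  universal_whittaker m phD phI p1 p2 p3 rho' w' ->
  exists f g, [/\ Lhom rho rho' f, Lhom rho' rho g, cancel f g & cancel g f].
Proof.
move=> [ww uw] [ww' uw'].
have [f [[fh fw] _]] := uw _ _ _ ww'; have [g [[gh gw] _]] := uw' _ _ _ ww.
exists f, g; split=> // v.
  have [h [_ hu]] := uw _ _ _ ww.
  transitivity (h v); first by apply: (hu (g \o f)) => //=; [exact: Lhom_comp fh gh|rewrite fw].
  by apply/esym/(hu id) => //; apply: Lhom_id.
have [h [_ hu]] := uw' _ _ _ ww'.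
transitivity (h v); first by apply: (hu (f \o g)) => //=; [exact: Lhom_comp gh fh|rewrite gw].
by apply/esym/(hu id) => //; apply: Lhom_id.
Qed.

Lemma simple_universal m phD phI p1 p2 p3 (V V' : lmodType CC) (rho : Lrep V)
    (rho' : Lrep V') w w' :
  universal_whittaker m phD phI p1 p2 p3 rho w ->
  universal_whittaker m phD phI p1 p2 p3 rho' w' ->
  simple_module rho <-> simple_module rho'.
Proof.
move=> uw uw'; have [f [g [fh gh fg gf]]] := universal_iso uw uw'.
by split; apply: simple_transfer; eassumption.
Qed.

(** * The model over the complex numbers and the two directions *)

Section InducedWhittaker.
Variables (m : nat) (phD phI : int -> CC) (p1 p2 : CC).
Hypothesis m_gt0 : (0 < m)%N.
Hypothesis hhom : is_Lie_hom m phD phI p1 p2 0.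

Let hDD : forall a b : int, m%:Z <= a -> m%:Z <= b ->
  (b - a)%:~R * phD (b + a) + om_dd p1 a b = 0.
Proof. by case: hhom. Qed.

Let hDI : forall a b : int, m%:Z <= a -> 0 <= b ->
  b%:~R * phI (b + a) + om_dI p2 a b = 0.
Proof. by case: hhom => _ []. Qed.

Lemma CC_char0 : [pchar CC] =i pred0.
Proof. exact: (@pchar_num (Rdefinitions.R)[i]). Qed.

Local Notation S := (free_module_on CC (word (bool * nat)%type)).
Local Notation mon := (@mon CC (bool * nat)%type).
Local Notation wact := (act (wletter m) (windex m) (@wc CC) (wom p1 p2) wbr (wphi phD phI)).

Lemma CC_rel x y (v : S) : wact x (wact y v) - wact y (wact x v) =
  @wc CC x y *: wact (wbr x y) v + wom p1 p2 x y *: v.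
Proof.
by apply/eqP; rewrite subr_eq (wact_rel m_gt0 hDD hDI) -addrA addrC.
Qed.

Lemma scale_if (b : bool) (a c : CC) (v : S) :
  (if b then a * c else 0) *: v = if b then a *: (c *: v) else 0.
Proof. by case: b; rewrite ?scalerA ?scale0r. Qed.

Definition whittaker_rep : Lrep S.
Proof.
refine (@Build_Lrep S (fun n => wact (true, n)) (fun n => wact (false, n))
  (fun v => p1 *: v) (fun v => p2 *: v) (fun v => 0 *: v) _ _ _ _ _ _ _ _ _ _ _ _ _ _ _ _ _).
- by move=> n; apply: act_is_linear.
- by move=> n; apply: act_is_linear.
- by move=> a u v; rewrite scalerDr !scalerA mulrC.
- by move=> a u v; rewrite scalerDr !scalerA mulrC.
- by move=> a u v; rewrite !scale0r scaler0 addr0.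
- by move=> n k v; rewrite CC_rel /wc /wom /= /om_dd scale_if.
- by move=> n k v; rewrite CC_rel /wc /wom /= /om_dI scale_if.
- move=> n k v; rewrite CC_rel /wc /wom /= !scale0r addr0; case: ifP => // _.
  by rewrite scaler0.
all: by move=> *; rewrite ?actZ // !scalerA mulrC.
Defined.

Lemma unit_whittaker : whittaker_vec m phD phI p1 p2 0 whittaker_rep (mon [::]).
Proof.
split; first by move=> i i0; apply: act_base; apply/windex_ge.
split; first by move=> i i0; apply: act_base; apply/windex_ge; rewrite /= lerDl.
by [].
Qed.

Section Universal.
Variables (V : lmodType CC) (rho : Lrep V) (w : V).
Hypothesis ww : whittaker_vec m phD phI p1 p2 0 rho w.

Definition rho_fun (x : bool * int) : V -> V :=
  if x.1 then rd rho x.2 else rI rho x.2.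
Fact rho_fun_linear x : linear (rho_fun x).
Proof. by rewrite /rho_fun; case: x.1; [apply: rd_lin|apply: rI_lin]. Qed.
HB.instance Definition _ x :=
  GRing.isLinear.Build CC V V *:%R (rho_fun x) (rho_fun_linear x).
Definition rho_op x : {linear V -> V} := rho_fun x.

Local Notation wop := (word_op (wletter m) rho_op w).
Local Notation weval := (eval (wletter m) rho_op w).

Lemma rho_opZ x a v : rho_op x (a *: v) = a *: rho_op x v.
Proof. exact: linearZ. Qed.

Lemma rho_op0 x : rho_op x 0 = 0.
Proof. exact: linear0. Qed.

Lemma word_op_central s :
  [/\ rz1 rho (wop s) = p1 *: wop s, rz2 rho (wop s) = p2 *: wop s
    & rz3 rho (wop s) = 0].
Proof.
case: ww => _ [_ [w1 [w2 w3]]]; elim: s => [|i s [h1 h2 h3]] /=.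
  by rewrite w1 w2 w3 scale0r.
have central x v : [/\ rz1 rho (rho_op x v) = rho_op x (rz1 rho v),
    rz2 rho (rho_op x v) = rho_op x (rz2 rho v)
    & rz3 rho (rho_op x v) = rho_op x (rz3 rho v)].
  rewrite /rho_op /= /rho_fun; case: x.1; split;
    by [apply: z1_d|apply: z2_d|apply: z3_d|apply: z1_I|apply: z2_I|apply: z3_I].
have [-> -> ->] := central (wletter m i) (wop s).
by rewrite h1 h2 h3 !rho_opZ rho_op0.
Qed.

Lemma rho_rel x y s : rho_op x (rho_op y (wop s)) =
  rho_op y (rho_op x (wop s)) + @wc CC x y *: rho_op (wbr x y) (wop s)
  + wom p1 p2 x y *: wop s.
Proof.
have [h1 h2 h3] := word_op_central s.
have ifE (b : bool) (a c : CC) (v : V) :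
    (if b then a *: (c *: v) else 0) = (if b then a * c else 0) *: v.
  by case: b; rewrite ?scalerA ?scale0r.
apply/eqP; rewrite -addrA [X in _ == X]addrC -subr_eq; apply/eqP.
rewrite /rho_op /= /rho_fun /wc /wom /wbr; case: x y => [[] n] [[] k] /=.
- by rewrite br_dd h1 ifE.
- by rewrite br_dI h2 ifE.
- rewrite -[LHS]opprB br_dI h2 ifE opprD -!scaleNr -rmorphN (addrC n).
  by [].
- rewrite br_II h3 scaler0 if_same !scale0r addr0.
  by [].
Qed.

Lemma rho_base x : windex m x = None -> rho_op x w = wphi phD phI x *: w.
Proof.
case: ww => wI [wd _]; rewrite windex_ge /rho_op /= /rho_fun /wphi /gap.
case: x => [[] n] /= n0; last exact: wI.
by have := wd (n - m%:Z); rewrite subr_ge0 [m%:Z + _]addrC subrK => ->.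
Qed.

Lemma weval_act x v : weval (wact x v) = rho_op x (weval v).
Proof. exact: (eval_act (wletterK m) (@windexK m) rho_rel rho_base). Qed.

Lemma weval_scale (z : V -> V) (p : CC) : linear z ->
  (forall s, z (wop s) = p *: wop s) -> forall v, weval (p *: v) = z (weval v).
Proof.
move=> z_lin zs; apply: free_ind => [|a u v hu hv|k].
- rewrite scaler0 linear0; have := z_lin (-1) 0 0.
  by rewrite scaler0 addr0 scaleN1r addNr.
- rewrite scalerDr scalerA mulrC -scalerA.
  by rewrite !(eval_linear (wletter m) rho_op w a) hu hv -z_lin.
- by rewrite linearZ /= mon_spell eval_mon ?zs //; apply: spellP.
Qed.

Lemma weval_hom : Lhom whittaker_rep rho weval.
Proof.
split; first exact: eval_linear.
split; first by move=> n v; apply: (weval_act (true, n)).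
split; first by move=> n v; apply: (weval_act (false, n)).
split; first by apply: weval_scale; [apply: rz1_lin|move=> s; have [] := word_op_central s].
split; first by apply: weval_scale; [apply: rz2_lin|move=> s; have [] := word_op_central s].
apply: weval_scale; first exact: rz3_lin.
by move=> s; have [_ _ ->] := word_op_central s; rewrite scale0r.
Qed.

Lemma weval_unique g : Lhom whittaker_rep rho g -> g (mon [::]) = w ->
  forall v, g v = weval v.
Proof.
move=> [g_lin [gd [gI _]]] gw; apply: (eval_unique (wletterK m) g_lin _ gw).
by move=> [[] n] v; [apply: gd|apply: gI].
Qed.
End Universal.

Lemma unit_universal :
  universal_whittaker m phD phI p1 p2 0 whittaker_rep (mon [::]).
Proof.
split; first exact: unit_whittaker.
move=> V rho w ww; exists (eval (wletter m) (rho_op rho) w); split.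
  by split; [apply: weval_hom|rewrite eval_mon].
exact: weval_unique.
Qed.

Lemma whittaker_rep_simple : phI m%:Z != 0 -> simple_module whittaker_rep.
Proof.
move=> Im; split; first by exists (mon [::]); apply: unit_neq0.
move=> P [P0 [PD [PZ [Pd [PI _]]]]].
case: (classic (exists2 v, P v & v != 0)) => [[v Pv v0]|nP]; [right|left].
  apply: (wact_simple m_gt0 hDD hDI CC_char0 Im v0 Pv).
    by move=> a u1 u2 Pu1 Pu2; apply: PD => //; apply: PZ.
  by move=> [[] n] u; [apply: Pd|apply: PI].
by move=> v Pv; apply/eqP/negPn/negP => v0; apply: nP; exists v.
Qed.

Lemma whittaker_rep_nonsimple : phI m%:Z = 0 -> ~ simple_module whittaker_rep.
Proof.
move=> Im [_ simp].
have [u [a [t [uW a0 t0 lead]]]] :=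
  nonscalar_whittaker_exists (p1 := p1) m_gt0 hDD hDI CC_char0 Im.
have uwv : whittaker_vec m phD phI p1 p2 0 whittaker_rep u.
  have ux x : windex m x = None -> wact x u = wphi phD phI x *: u.
    by move=> xN; apply/eqP; rewrite -subr_eq0; apply/eqP; apply: uW.
  split; first by move=> i i0; apply: (ux (false, i)); apply/windex_ge.
  by split; first by move=> i i0; apply: (ux (true, _)); apply/windex_ge; rewrite /= lerDl.
have [_ univ] := unit_universal.
have [f [[fh fu] _]] := univ _ _ _ uwv.
case: (fh) => fl [fd [fI [f1 [f2 f3]]]].
have f0 := Lhom0 fh.
have f_act x v : f (wact x v) = wact x (f v) by case: x => [[] n]; [apply: fd|apply: fI].
have f_unit v : f v <> mon [::].
  by apply: (wact_raise m_gt0 (p1 := p1) (p2 := p2) fl f_act a0 t0); rewrite fu.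
(* The image of [f] contradicts simplicity: it contains [u], whose coefficient at [t] is [a], and it
   misses the generator. *)
case: (simp (fun v => exists v', v = f v')).
- split; first by exists 0.
  split; first by move=> _ _ [v ->] [v' ->]; exists (1 *: v + v'); rewrite fl scale1r.
  split; first by move=> b _ [v ->]; exists (b *: v + 0); rewrite fl f0 addr0.
  split; first by move=> n _ [v ->]; exists (rd whittaker_rep n v); rewrite fd.
  split; first by move=> n _ [v ->]; exists (rI whittaker_rep n v); rewrite fI.
  split; first by move=> _ [v ->]; exists (rz1 whittaker_rep v); rewrite f1.
  by split=> _ [v ->]; [exists (rz2 whittaker_rep v); rewrite f2|exists (rz3 whittaker_rep v); rewrite f3].
- move=> /(_ u) u0; have {}u0 : u = 0 by apply: u0; exists (mon [::]).
  move: lead; rewrite u0 sub0r => /(_ (to_word t)).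
  rewrite fm_coefN fm_coefZ coef_mon perm_sym perm_spell_to_word mulr1 oppr_eq0.
  move=> /(_ a0); rewrite /wt_lt (weight_perm _ (perm_spell_to_word t)) ltnn.
  by [].
- by move=> /(_ (mon [::])) [v /esym]; apply: f_unit.
Qed.

End InducedWhittaker.

Theorem theorem14 (m : nat) (hm : (1 <= m)%N)
  (phD phI : int -> CC) (p1 p2 p3 : CC)
  (hhom : is_Lie_hom m phD phI p1 p2 p3) (hz3 : p3 = 0) :
  (exists (V : lmodType CC) (rho : Lrep V) (w : V),
      universal_whittaker m phD phI p1 p2 p3 rho w)
  /\ (forall (V : lmodType CC) (rho : Lrep V) (w : V),
      universal_whittaker m phD phI p1 p2 p3 rho w ->
      (simple_module rho <-> phI m%:Z != 0)).
Proof.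
subst p3; have univ := unit_universal hm hhom.
split; first by do 3 eexists; apply: univ.
move=> V rho w uw; apply: iff_trans (simple_universal uw univ) _.
split; last exact: whittaker_rep_simple.
by move=> simp; apply/negP => /eqP/(@whittaker_rep_nonsimple _ _ _ _ _ hm hhom).
Qed.
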